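(* Let $k$ be a field, let $(B,m_\bullet)$ be an (resp., a unitary) $A_\infty$-algebra over $k$ provided with a compatible bigrading of $0$-th type, and let $(B_\hbar,\tilde m_\bullet)$ be a formal bigraded deformation of $B$. Let $\bar B=B_\hbar/(\hbar-1)$ be the filtered (resp., filtered unitary) $A_\infty$-algebra with the filtration $\{F^p\bar B\}_{p\in\mathbb{Z}}$ described in the context. Then $B_\hbar$ and the Rees $A_\infty$-algebra $\mathrm{Re}_{F^\bullet\bar B}(\bar B)$ are strictly isomorphic as (resp., unitary) $A_\infty$-algebras over $k[\hbar]$ provided with compatible bigradings of $0$-th type. Moreover, the formal bigraded deformations of $B$ that they define are strictly isomorphic, in such a way that the induced map on $B$ is the identity.
   Context: Conventions: $\mathbb{N}$ is the set of positive integers, $\mathbb{N}_0=\mathbb{N}\cup\{0\}$, $\otimes=\otimes_k$, and the Koszul sign rule (for the cohomological degree) is used. $A_\infty$-algebras. An $A_\infty$-algebra over a commutative ring is a graded module $A$ with linear maps $m_i:A^{\otimes i}\to A$ of degree $2-i$, $i\in\mathbb{N}$, with $\sum_{r+s+t=n,\ r,t\ge0,\ s\ge1}(-1)^{r+st}m_{r+1+t}\circ(\mathrm{id}^{\otimes r}\otimes m_s\otimes\mathrm{id}^{\otimes t})=0$ for all $n\in\mathbb{N}$. It is unitary if it has a degree $0$ element $1_A$ that is a two-sided unit for $m_2$ and such that $m_i$, $i\ne2$, vanishes if one argument is $1_A$. A strict morphism is a degree $0$ linear map $f$ with $f\circ m_i=m_i\circ f^{\otimes i}$ for all $i$ (preserving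 the unit in the unitary case); a strict isomorphism is a bijective strict morphism (here also homogeneous of bidegree $(0,0)$). $A$ has a compatible bigrading of $0$-th type if $A=\bigoplus_{p,q\in\mathbb{Z}}A^{p,q}$, $A^n=\bigoplus_pA^{p,n-p}$ and $m_n$ has bidegree $(0,2-n)$ for all $n$ (and $1_A\in A^{0,0}$ in the unitary case). Formal bigraded deformations. $k[\hbar]$ is bigraded with $\hbar$ in bidegree $(-1,1)$. The bigraded completion of a bigraded $k[\hbar]$-module $M$ is the inverse limit over $N$ of $M\otimes_{k[\hbar]}k[\hbar]/(\hbar^N)$ in bigraded $k[\hbar]$-modules; $\hat\otimes^{\mathrm{bgr}}_{k[\hbar]}$ is the bigraded completion of $\otimes_{k[\hbar]}$. For a bigraded $k$-module $V$, $V[[\hbar]]^{\mathrm{bgr}}=\bigoplus_{p,q}\prod_{r\ge0}(V^{p+r,q-r}\otimes k\hbar^r)$, the bigraded completion of $V\otimes k[\hbar]$. A formal bigraded deformation $B_\hbar$ of $B$ (with bigrading of $0$-th type) is $B[[\hbar]]^{\mathrm{bgr}}$ with $k[\hbar]$-linear maps $\tilde m_n:B_\hbar^{\hat\otimes^{\mathrm{bgr}}_{k[\hbar]}n}\to B_\hbar$ of bidegree $(0,2-n)$, $n\in\mathbb{N}$, whose reductions modulo $\hbar^{N+1}$ define, for every $N\in\mathbb{N}$, a (resp., unitary, with unit $1_B\otimes1$) $A_\infty$-algebra over $k[\hbar]/(\hbar^{N+1})$, and whose reductions modulo $\hbar$ are the $m_n$. A strict isomorphism of formal bigraded deformations is a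 strict isomorphism over $k[\hbar]$ of bidegree $(0,0)$; its reduction modulo $\hbar$ is the induced map on the undeformed algebras. Filtered algebras. A filtered $A_\infty$-algebra is an $A_\infty$-algebra $A$ over $k$ with a decreasing filtration by graded submodules $F^pA$, $p\in\mathbb{Z}$, such that $m_n(F^{p_1}A\otimes\dots\otimes F^{p_n}A)\subseteq F^{p_1+\dots+p_n}A$ (and $1_A\in F^0A$ in the unitary case), and which is exhaustive and graded complete, i.e. $A\to\varprojlim_q A/F^qA$ is an isomorphism, the limit being taken in graded modules. Its Rees $A_\infty$-algebra is $\mathrm{Re}_{F^\bullet A}(A)=\bigoplus_{p\in\mathbb{Z}}(F^pA\otimes k\hbar^{-p})\subseteq A\otimes k[\hbar^{\pm1}]$ with structure maps $m_n^{\mathrm{re}}(a_1\otimes\hbar^{-p_1},\dots,a_n\otimes\hbar^{-p_n})=m_n(a_1,\dots,a_n)\otimes\hbar^{-(p_1+\dots+p_n)}$, the obvious $k[\hbar]$-action, and $F^pA^{p+q}\otimes\hbar^{-p}$ in bidegree $(p,q)$. The associated graded $\mathrm{Gr}_{F^\bullet A}(A)$, with $(p,q)$-component $F^pA^{p+q}/F^{p+1}A^{p+q}$, is an $A_\infty$-algebra with induced structure maps and compatible bigrading of $0$-th type. The Rees algebra is regarded as a formal bigraded deformation of $\mathrm{Gr}_{F^\bullet A}(A)$ as follows: choose graded complements $X^p$ with $F^pA=X^p\oplus F^{p+1}A$, let $\pi^p_q:F^pA\to X^q$ ($q\ge p$) be the resulting projections and $\mathrm{proj}_q:F^qA\to F^qA/F^{q+1}A$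 the canonical projections; then structure maps are transported along the isomorphism of bigraded $k[\hbar]$-modules $\mathrm{Re}_{F^\bullet A}(A)\to\mathrm{Gr}_{F^\bullet A}(A)[[\hbar]]^{\mathrm{bgr}}$, $\sum_p a_p\otimes\hbar^{-p}\mapsto\sum_p\sum_{q\ge p}\mathrm{proj}_q(\pi^p_q(a_p))\otimes\hbar^{q-p}$ (finite sums over $p$). The filtered algebra $\bar B$. Since $\hbar$ has total degree $0$, $\bar B=B_\hbar/(\hbar-1)B_\hbar$ is graded by total degree, and the $k[\hbar]$-linear maps $\tilde m_n$ induce on it a (resp., unitary) $A_\infty$-algebra structure over $k$. Let $F^pB=\bigoplus_{p'\ge p}\bigoplus_qB^{p',q}$ and let $\hat B^{\mathrm{gr}}$ be the graded completion of $B$ for this filtration: its degree $n$ part consists of the families $\hat b=\sum_{p\in\mathbb{Z}}b_{p,n-p}$, $b_{p,n-p}\in B^{p,n-p}$, with $b_{p,n-p}=0$ for all $p$ smaller than some integer; $F^p\hat B^{\mathrm{gr}}$ consists of the elements whose components $b_{p',n-p'}$ with $p'<p$ all vanish. For nonzero $\hat b$ of degree $n$ let $P_n(\hat b)$ be the smallest $p$ with $b_{p,n-p}\neq0$. The map sending $\hat b$ of degree $n$ to the class in $\bar B$ of $\sum_{r\ge0}b_{P_n(\hat b)+r,\,n-P_n(\hat b)-r}\,\hbar^r\in B_\hbar$ is an isomorphism of graded $k$-modules $\iota':\hat B^{\mathrm{gr}}\to\bar B$, and $F^p\bar B=\iota'(F^p\hat B^{\mathrm{gr}})$. With this filtration $\bar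 B$ is a filtered (resp., filtered unitary) $A_\infty$-algebra. One identifies $\mathrm{Gr}_{F^\bullet\bar B}(\bar B)$ with $B$ through the maps $F^p\bar B^n/F^{p+1}\bar B^n\to B^{p,n-p}$ induced by $\iota'(\hat b)\mapsto b_{p,n-p}$; in this way $\mathrm{Re}_{F^\bullet\bar B}(\bar B)$ is a formal bigraded deformation of $B$. *)

(* Defs.v *)
From HB Require Import structures.
From mathcomp Require Import all_boot all_order all_algebra.
From mathcomp Require Import mathcomp_extra boolp classical_sets functions.
From mathcomp Require Import cardinality fsbigop.

Set Implicit Arguments.
Unset Strict Implicit.
Unset Printing Implicit Defensive.

Import Order.TTheory GRing.Theory Num.Theory.
Local Open Scope classical_set_scope.
Local Open Scope quotient_scope.
Local Open Scope ring_scope.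

Section Submodules.
Variables (R : pzRingType) (M : lmodType R).

Definition lin_closed (S : M -> Prop) : Prop :=
  S 0 /\ forall c x y, S x -> S y -> S (c *: x + y).

Record submod := Submod { submod_set :> M -> Prop;
                          submodP : lin_closed submod_set }.

Lemma submod0 (S : submod) : S 0. Proof. by case: (submodP S). Qed.

Lemma submodL (S : submod) c x y : S x -> S y -> S (c *: x + y).
Proof. by case: (submodP S) => _; exact. Qed.

Lemma submodZ (S : submod) c x : S x -> S (c *: x).
Proof. by move=> Sx; rewrite -[_ *: _]addr0; apply: submodL (submod0 S). Qed.

Lemma submodD (S : submod) x y : S x -> S y -> S (x + y).
Proof. by move=> Sx Sy; rewrite -[x]scale1r; apply: submodL. Qed.

Lemma submodB (S : submod) x y : S x -> S y -> S (x - y).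
Proof. by move=> Sx Sy; rewrite addrC -scaleN1r; apply: submodL. Qed.

Definition submod_mem (S : submod) : {pred M} := fun x => `[< S x >].

Lemma submod_memE (S : submod) x : (x \in submod_mem S) <-> S x.
Proof. by split => [/asboolP|Sx]; last exact/asboolP. Qed.

Fact submod_mem_closed (S : submod) : zmod_closed (submod_mem S).
Proof.
split=> [|x y /submod_memE Sx /submod_memE Sy]; apply/submod_memE.
  exact: submod0.
exact: submodB.
Qed.

HB.instance Definition _ (S : submod) :=
  GRing.isZmodClosed.Build M (submod_mem S) (submod_mem_closed S).

Definition quotm (S : submod) : Type := Quotient.quot (submod_mem S).

HB.instance Definition _ (S : submod) := GRing.Zmodule.on (quotm S).

Definition qpi (S : submod) (x : M) : quotm S :=
  \pi_(Quotient.quot (submod_mem S)) x.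

Definition qrepr (S : submod) (x : quotm S) : M :=
  repr (x : Quotient.quot (submod_mem S)).

Lemma qreprK (S : submod) (x : quotm S) : qpi S (qrepr x) = x.
Proof. exact: reprK. Qed.

Lemma qpiP (S : submod) x y : qpi S x = qpi S y <-> S (x - y).
Proof.
rewrite -submod_memE /qpi; split=> [/eqP|h].
  by rewrite -Quotient.idealrBE.
by apply/eqP; rewrite -Quotient.idealrBE.
Qed.

Lemma qpiD (S : submod) x y : qpi S (x + y) = qpi S x + qpi S y.
Proof. by rewrite /qpi; exact: Quotient.pi_add. Qed.

Lemma qpi0 (S : submod) : qpi S 0 = 0.
Proof. by apply: (addrI (qpi S 0)); rewrite -qpiD !addr0. Qed.

Definition qscale (S : submod) (c : R) (x : quotm S) : quotm S :=
  qpi S (c *: qrepr x).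

Lemma qpiZ (S : submod) c x : qscale c (qpi S x) = qpi S (c *: x).
Proof.
by apply/qpiP; rewrite -scalerBr; apply/submodZ/qpiP; rewrite qreprK.
Qed.

Fact qscaleA S a b (x : quotm S) : qscale a (qscale b x) = qscale (a * b) x.
Proof. by rewrite -[x]qreprK !qpiZ scalerA. Qed.

Fact qscale1 S : left_id 1 (@qscale S).
Proof. by move=> x; rewrite -[x]qreprK qpiZ scale1r. Qed.

Fact qscaleDr S : right_distributive (@qscale S) +%R.
Proof.
by move=> c x y; rewrite -[x]qreprK -[y]qreprK -qpiD !qpiZ -qpiD scalerDr.
Qed.

Fact qscaleDl S (x : quotm S) : {morph (@qscale S)^~ x : a b / a + b}.
Proof. by move=> a b /=; rewrite -[x]qreprK !qpiZ -qpiD scalerDl. Qed.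

HB.instance Definition _ (S : submod) :=
  GRing.Zmodule_isLmodule.Build R (quotm S)
    (@qscaleA S) (@qscale1 S) (@qscaleDr S) (@qscaleDl S).

End Submodules.

Section QuotientFamilies.
Variables (R : pzRingType) (M : lmodType R) (S : submod M).

Definition qimage (T : M -> Prop) : quotm S -> Prop :=
  fun y => exists2 x, T x & y = qpi S x.

Fact qimage_lin_closed (T : submod M) : lin_closed (qimage T).
Proof.
split=> [|c _ _ [x Tx ->] [y Ty ->]].
  by exists 0; [exact: submod0 | rewrite qpi0].
exists (c *: x + y); first exact: submodL.
by rewrite qpiD -qpiZ.
Qed.

Definition qimage_submod (T : submod M) : submod (quotm S) :=
  Submod (qimage_lin_closed T).

Definition qop (m : seq M -> M) : seq (quotm S) -> quotm S :=
  fun a => qpi S (m (map (@qrepr _ _ S) a)).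

End QuotientFamilies.

Arguments qimage {R M} S T _.
Arguments qimage_submod {R M} S T.
Arguments qop {R M} S m _.

(* [gsum P G] is the set of finite sums of elements of the [G i] with [P i]. *)
Definition gsum (I : eqType) (M : zmodType) (P : I -> Prop)
    (G : I -> M -> Prop) : M -> Prop :=
  fun x => exists2 s : seq (I * M),
    (forall z, z \in s -> P z.1 /\ G z.1 z.2) & x = \sum_(z <- s) z.2.

Record direct_sum (I : eqType) (M : zmodType) (G : I -> M -> Prop) : Prop := {
  direct_sum0 : forall i, G i 0;
  direct_sumB : forall i x y, G i x -> G i y -> G i (x - y);
  direct_sum_span : forall x, gsum (fun=> True) G x;
  direct_sum_free : forall (s : seq I) (f : I -> M), uniq s ->
    (forall i, i \in s -> G i (f i)) -> \sum_(i <- s) f i = 0 ->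
    forall i, i \in s -> f i = 0
}.

Fact gsum_lin_closed (R : pzRingType) (I : eqType) (M : lmodType R)
    (P : I -> Prop) (G : I -> M -> Prop) :
  (forall i c x, G i x -> G i (c *: x)) -> lin_closed (gsum P G).
Proof.
move=> GZ; split=> [|c _ _ [s hs ->] [t ht ->]]; first by exists [::]; rewrite ?big_nil.
exists ([seq (z.1, c *: z.2) | z <- s] ++ t) => [z|].
  rewrite mem_cat => /orP[/mapP[y /hs[Py Gy] ->]|/ht//].
  by split=> //; exact: GZ.
by rewrite big_cat big_map scaler_sumr.
Qed.

Definition gsum_submod (R : pzRingType) (I : eqType) (M : lmodType R)
    (P : I -> Prop) (G : I -> submod M) : submod M :=
  Submod (gsum_lin_closed P (fun i c x => @submodZ _ _ (G i) c x)).

Definition total (M : zmodType) (G : int * int -> M -> Prop) (n : int) :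
    M -> Prop := gsum (fun pq => pq.1 + pq.2 = n) G.

Definition total_submod (R : pzRingType) (M : lmodType R)
    (G : int * int -> submod M) (n : int) : submod M :=
  gsum_submod (fun pq => pq.1 + pq.2 = n) G.

Definition component (I : eqType) (M : zmodType) (G : I -> M -> Prop) (i : I)
    (x : M) : M :=
  xget 0 [set y | G i y /\ gsum (fun j => j <> i) G (x - y)].

Definition lies_in (I : zmodType) (M : zmodType) (G : I -> M -> Prop)
    (d : seq I) (a : seq M) : Prop :=
  size d = size a /\ forall i, (i < size a)%N -> G d`_i a`_i.

(* The operations [m_n], [n >= 1], are packed in a single function [m] on
   lists: [m [:: a_1; ...; a_n]] is [m_n (a_1, ..., a_n)].  The value on the
   empty list is irrelevant.  An optional unit [e : option A] covers both the
   non-unitary case [None] and the unitary case [Some 1_A]. *)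

Definition multilinear (R : pzRingType) (A B : lmodType R) (m : seq A -> B) :=
  forall a b c x y,
    m (a ++ c *: x + y :: b) = c *: m (a ++ x :: b) + m (a ++ y :: b).

(* The Stasheff sum evaluated on homogeneous arguments [a] of degrees [d]; as
   [m_s] has degree [2 - s], moving it past the first [r] arguments produces
   the Koszul sign [(-1)^(s (d_1 + ... + d_r))]. *)
Definition stasheff (R : pzRingType) (A : lmodType R) (m : seq A -> A)
    (d : seq int) (a : seq A) : A :=
  \sum_(0 <= r < size a) \sum_(1 <= s < (size a - r).+1)
    (-1) ^+ (r + s * (size a - r - s) + s * `|(\sum_(i <- take r d) i)%R|) *:
      m (take r a ++ m (take s (drop r a)) :: drop (r + s) a).

Definition unital (A : zmodType) (m : seq A -> A) (u : A) : Prop :=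
  [/\ forall x, m [:: u; x] = x,
      forall x, m [:: x; u] = x &
      forall a, u \in a -> size a <> 2 -> m a = 0].

Record ainf_algebra (R : pzRingType) (A : lmodType R) (gr : int -> A -> Prop)
    (m : seq A -> A) (e : option A) : Prop := {
  ainf_direct : direct_sum gr;
  ainf_scale : forall n c x, gr n x -> gr n (c *: x);
  ainf_linear : multilinear m;
  ainf_degree : forall d a, a <> [::] -> lies_in gr d a ->
    gr (\sum_(i <- d) i + (2 - (size a)%:Z)) (m a);
  ainf_relation : forall d a, a <> [::] -> lies_in gr d a ->
    stasheff m d a = 0;
  ainf_unit : forall u, e = Some u -> gr 0 u /\ unital m u
}.

Definition bihomogeneous (A : zmodType) (G : int * int -> A -> Prop)
    (m : seq A -> A) : Prop :=
  forall d a, a <> [::] -> lies_in G d a ->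
    G (\sum_(i <- d) i + (0, 2 - (size a)%:Z)) (m a).

(* A-infinity algebras with a compatible bigrading of 0-th type over a
   commutative ring [R] which is itself bigraded by [RG]. *)
Record bigraded_ainf (R : pzRingType) (RG : int * int -> R -> Prop)
    (A : lmodType R) (G : int * int -> A -> Prop) (m : seq A -> A)
    (e : option A) : Prop := {
  bigr_ainf : ainf_algebra (total G) m e;
  bigr_direct : direct_sum G;
  bigr_scale : forall i j c x, RG i c -> G j x -> G (i + j) (c *: x);
  bigr_degree : bihomogeneous G m;
  bigr_unit : forall u, e = Some u -> G 0 u
}.

Definition bigr_trivial (R : pzRingType) (i : int * int) (c : R) : Prop :=
  i = 0 \/ c = 0.

(* The bigrading of [k[hbar]], with [hbar = 'X] in bidegree (-1, 1). *)
Definition bigr_hbar (k : nzRingType) (i : int * int) (c : {poly k}) : Prop :=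
  forall j : nat, c`_j != 0 -> i = (- j%:Z, j%:Z).

Record graded_iso (R : pzRingType) (I : eqType) (A A' : lmodType R)
    (G : I -> A -> Prop) (G' : I -> A' -> Prop) (f : A -> A') : Prop := {
  iso_linear : forall c x y, f (c *: x + y) = c *: f x + f y;
  iso_bij : bijective f;
  iso_degree : forall i x, G i x -> G' i (f x)
}.

Record strict_iso (R : pzRingType) (I : eqType) (A A' : lmodType R)
    (G : I -> A -> Prop) (m : seq A -> A) (e : option A)
    (G' : I -> A' -> Prop) (m' : seq A' -> A') (e' : option A')
    (f : A -> A') : Prop := {
  strict_graded_iso : graded_iso G G' f;
  strict_morphism : forall a, a <> [::] -> f (m a) = m' (map f a);
  strict_unit : omap f e = e'
}.

(* A [k[hbar]]-module is a [k]-module with an endomorphism, the action of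
   [hbar = 'X]. *)
Section PolyModule.
Variables (k : comNzRingType) (V : lmodType k) (phi : {linear V -> V}).

Definition polymod : Type := let _ := phi in V.

HB.instance Definition _ := GRing.Zmodule.copy polymod V.

Definition pscale (c : {poly k}) (v : polymod) : polymod :=
  \sum_(i < size c) c`_i *: iter i phi (v : V).

Lemma pscale_widen n (c : {poly k}) (v : polymod) : (size c <= n)%N ->
  pscale c v = \sum_(i < n) c`_i *: iter i phi (v : V) :> V.
Proof.
move=> cn; rewrite /pscale (big_ord_widen _ (fun i => c`_i *: iter i phi (v : V)) cn).
rewrite big_mkcond /=; apply: eq_bigr => i _; case: ltnP => // ci.
by rewrite nth_default // scale0r.
Qed.

Fact pscaleDl v : {morph pscale^~ v : a b / a + b}.
Proof.
move=> a b /=; set n := maxn (size a) (size b).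
rewrite (@pscale_widen n (a + b)) ?size_polyD //.
rewrite (@pscale_widen n a) ?leq_maxl // (@pscale_widen n b) ?leq_maxr //.
by rewrite -big_split; apply: eq_bigr => i _; rewrite coefD scalerDl.
Qed.

Lemma iter_phiL i c x y :
  iter i phi (c *: x + y) = c *: iter i phi x + iter i phi y.
Proof. by elim: i => //= i ->; rewrite linearP. Qed.

Fact pscaleDr : right_distributive pscale +%R.
Proof.
move=> c x y; rewrite /pscale -big_split; apply: eq_bigr => i _ /=.
by rewrite -[X in iter i phi (X + _)]scale1r iter_phiL scale1r scalerDr.
Qed.

Lemma pscaleC (c : k) v : pscale c%:P v = c *: (v : V).
Proof.
by rewrite (@pscale_widen 1) ?size_polyC ?leq_b1 // big_ord1 coefC eqxx.
Qed.

Fact pscale1 : left_id 1 pscale.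
Proof. by move=> v; rewrite -[1]/(1%:P) pscaleC scale1r. Qed.

Lemma pscaleCM (c : k) a v : pscale (c%:P * a) v = c *: (pscale a v : V).
Proof.
rewrite (@pscale_widen (size a)); last by rewrite mul_polyC size_scale_leq.
by rewrite /pscale scaler_sumr; apply: eq_bigr => i _;
  rewrite coefCM scalerA.
Qed.

Lemma pscaleXM a v : pscale (a * 'X) v = phi (pscale a v).
Proof.
rewrite (@pscale_widen (size a).+1); last first.
  by apply: leq_trans (size_polyMleq _ _) _; rewrite size_polyX addn2.
rewrite big_ord_recl coefMX scale0r add0r /pscale linear_sum.
by apply: eq_bigr => i _; rewrite coefMX linearZ.
Qed.

Fact pscaleA a b v : pscale a (pscale b v) = pscale (a * b) v.
Proof.
elim/poly_ind: a => [|a c IH].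
  by rewrite mul0r /pscale size_poly0 !big_ord0.
by rewrite mulrDl !pscaleDl pscaleC pscaleCM mulrAC !pscaleXM IH.
Qed.

HB.instance Definition _ := GRing.Zmodule_isLmodule.Build {poly k} polymod
  pscaleA pscale1 pscaleDr pscaleDl.

Lemma polymodC (c : k) (v : polymod) : c%:P *: v = c *: (v : V).
Proof. exact: pscaleC. Qed.

Lemma polymodX (v : polymod) : 'X *: v = phi v.
Proof.
by rewrite -['X]mul1r -[LHS]/(pscale _ _) pscaleXM pscale1.
Qed.

Fact hbar_lin_closed (h : {poly k}) :
  lin_closed (fun x : V => exists y : polymod, x = h *: y).
Proof.
split=> [|c _ _ [x ->] [y ->]]; first by exists 0; rewrite scaler0.
exists (c%:P *: x + y); rewrite scalerDr; congr (_ + _).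
by rewrite scalerA mulrC -scalerA polymodC.
Qed.

(* [h M] as a [k]-submodule of the [k[hbar]]-module [M]. *)
Definition hbar_submod (h : {poly k}) : submod V := Submod (hbar_lin_closed h).

End PolyModule.

(* The module [M / hbar^(N+1) M] over [k[hbar]/(hbar^(N+1))]. *)
Section Truncation.
Variables (k : comNzRingType) (M : lmodType {poly k}) (N : nat).

Fact hpow_lin_closed :
  lin_closed (fun x : M => exists y : M, x = 'X^(N.+1) *: y).
Proof.
split=> [|c _ _ [x ->] [y ->]]; first by exists 0; rewrite scaler0.
by exists (c *: x + y); rewrite scalerDr !scalerA mulrC.
Qed.

Definition hpow_submod : submod M := Submod hpow_lin_closed.

Definition trunc : Type := quotm hpow_submod.

HB.instance Definition _ := GRing.Zmodule.copy trunc (quotm hpow_submod).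

Definition tscale (c : {poly %/ ('X^(N.+1) : {poly k})}) (x : trunc) : trunc :=
  (c : {poly k}) *: (x : quotm hpow_submod).

Lemma hpow_kill (x : quotm hpow_submod) : 'X^(N.+1) *: x = 0.
Proof.
rewrite -[x]qreprK -[LHS]/(qscale _ _) qpiZ.
rewrite -(qpi0 hpow_submod).
by apply/qpiP; exists (qrepr x); rewrite subr0.
Qed.

Lemma rmodp_scale (c : {poly k}) (x : quotm hpow_submod) :
  Pdiv.Ring.rmodp c (mk_monic 'X^(N.+1)) *: x = c *: x.
Proof.
rewrite [in RHS](Pdiv.RingMonic.rdivp_eq (monic_mk_monic 'X^(N.+1)) c) scalerDl.
by rewrite -scalerA mk_monic_Xn hpow_kill scaler0 add0r.
Qed.

Fact tscaleA a b x : tscale a (tscale b x) = tscale (a * b) x.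
Proof. by rewrite /tscale poly_of_qpolyM rmodp_scale scalerA. Qed.

Fact tscale1 : left_id 1 tscale.
Proof. by move=> x; rewrite /tscale /= scale1r. Qed.

Fact tscaleDr : right_distributive tscale +%R.
Proof. by move=> c x y; exact: scalerDr. Qed.

Fact tscaleDl x : {morph tscale^~ x : a b / a + b}.
Proof. by move=> a b; exact: scalerDl. Qed.

HB.instance Definition _ :=
  GRing.Zmodule_isLmodule.Build {poly %/ ('X^(N.+1) : {poly k})} trunc
    tscaleA tscale1 tscaleDr tscaleDl.

End Truncation.

Section Series.
Variables (k : comNzRingType) (B : lmodType k) (G : int * int -> submod B).

(* [f (p, q) r] in [B^(p + r, q - r)] is the coefficient of [hbar^r] of the
   component of bidegree (p, q). *)
Definition hser_spec (f : int * int -> nat -> B) : Prop :=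
  (forall pq r, G (pq.1 + r%:Z, pq.2 - r%:Z) (f pq r)) /\
  finite_set [set pq | f pq <> (fun=> 0)].

Definition hser_pred : {pred (int * int -> nat -> B)} :=
  fun f => `[< hser_spec f >].

Fact hser_submod_closed : submod_closed hser_pred.
Proof.
split=> [|c f g /asboolP[f1 f2] /asboolP[g1 g2]]; apply/asboolP; split.
- by move=> pq r; exact: submod0.
- rewrite (_ : [set _ | _] = set0) //; apply/seteqP; split=> // pq /=; exact.
- by move=> pq r; exact: submodL.
- apply: (@sub_finite_set _ _ ([set pq | f pq <> (fun=> 0)] `|`
      [set pq | g pq <> (fun=> 0)])); last by rewrite finite_setU.
  move=> pq /= h; apply: contrapT => /not_orP[/contrapT fE /contrapT gE].
  apply: h; apply/funext => r; rewrite [LHS]/(c *: f pq r + g pq r) fE gE.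
  by rewrite scaler0; exact: addr0.
Qed.

HB.instance Definition _ :=
  GRing.isSubmodClosed.Build k (int * int -> nat -> B) hser_pred
    hser_submod_closed.

Record hserk : Type :=
  Hser { hval : int * int -> nat -> B; hvalP : hval \in hser_pred }.

HB.instance Definition _ := [isSub for hval].
HB.instance Definition _ := [Choice of hserk by <:].
HB.instance Definition _ := [SubChoice_isSubLmodule of hserk by <:].

Definition hshift_fun (f : int * int -> nat -> B) (pq : int * int) (r : nat) :
  B := if r is r'.+1 then f (pq.1 + 1, pq.2 - 1) r' else 0.

Fact hshift_mem (f : hserk) : hshift_fun (hval f) \in hser_pred.
Proof.
case: f => f /= /asboolP[f1 f2]; apply/asboolP; split.
  move=> pq [|r] /=; first exact: submod0.
  have := f1 (pq.1 + 1, pq.2 - 1) r => /=.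
  by rewrite -!addrA -opprD -[1 + _]/(1%:Z + r%:Z) -PoszD add1n.
apply: (@sub_finite_set _ _ [set (x.1 - 1, x.2 + 1) |
    x in [set pq | f pq <> (fun=> 0)]]); last exact: finite_image.
move=> pq /= h; exists (pq.1 + 1, pq.2 - 1); last first.
  by rewrite /= addrK subrK; case: (pq).
by move=> E; apply: h; apply/funext => -[|r] //=; rewrite E.
Qed.

Definition hshift (f : hserk) : hserk := Hser (hshift_mem f).

Fact hshift_linear : linear hshift.
Proof.
move=> c f g; apply/val_inj/funext => pq; apply/funext => -[|r] //=.
by rewrite -[RHS]/(c *: 0 + 0) scaler0 addr0.
Qed.

HB.instance Definition _ := GRing.isLinear.Build k hserk hserk _ hshift
  hshift_linear.

Definition hser : Type := polymod hshift.
HB.instance Definition _ := GRing.Lmodule.copy hser (polymod hshift).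

Definition hser_gr (pq : int * int) : hser -> Prop :=
  fun f => forall pq', pq' <> pq -> hval f pq' = (fun=> 0).

Fact hser_gr_lin_closed pq : lin_closed (hser_gr pq : hserk -> Prop).
Proof.
split=> // c f g hf hg pq' h; apply/funext => r.
rewrite [LHS]/(c *: hval f pq' r + hval g pq' r) hf // hg // scaler0.
exact: addr0.
Qed.

Definition hser_gr_submod pq : submod hserk := Submod (hser_gr_lin_closed pq).

Definition hmono (pq : int * int) (c : nat -> B) : hserk :=
  insubd (0 : hserk) (fun pq' r => if pq' == pq then c r else 0).

Lemma hmonoE pq c : (forall r, G (pq.1 + r%:Z, pq.2 - r%:Z) (c r)) ->
  hval (hmono pq c) = fun pq' r => if pq' == pq then c r else 0.
Proof.
move=> Gc; rewrite [LHS]val_insubd ifT //; apply/asboolP; split=> [pq' r|].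
  by case: eqP => [->|_]; [exact: Gc | exact: submod0].
apply: (sub_finite_set _ (finite_set1 pq)) => pq' /=; case: eqP => // _; exact.
Qed.

Definition hunit (e : B) : hser := hmono (0, 0) (fun r => if r is 0 then e else 0).

(* Reduction modulo [hbar], through the identification of [B[[hbar]] / (hbar)]
   with [B]. *)
Definition hred (f : hser) : B := \sum_(pq \in [set: int * int]) hval f pq 0%N.

End Series.

Arguments hser_gr {k B} G pq _.
Arguments hser_gr_submod {k B} G pq.
Arguments hred {k B} G f.

Definition hser_map (k : comNzRingType) (B B' : lmodType k)
    (G : int * int -> submod B) (G' : int * int -> submod B') (f : B -> B')
    (x : hser G) : hser G' :=
  insubd (0 : hserk G') (fun pq r => f (hval x pq r)).

(* By the universal property of the completed tensor power, a [k[hbar]]-linear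
   map of bidegree (0, 2 - n) from it to the complete module [B[[hbar]]] is a
   [k[hbar]]-multilinear map of that bidegree on [B[[hbar]]]. *)
Record formal_deformation (k : comNzRingType) (B : lmodType k)
    (G : int * int -> submod B) (m : seq B -> B) (e : option B)
    (mt : seq (hser G) -> hser G) : Prop := {
  fd_linear : multilinear mt;
  fd_degree : bihomogeneous (hser_gr G) mt;
  fd_trunc : forall N, (0 < N)%N ->
    let S := hpow_submod (hser G) N in
    @ainf_algebra _ (trunc (hser G) N)
      (total (fun pq => qimage S (hser_gr G pq)))
      (qop S mt) (omap (fun u => qpi S (hunit G u)) e);
  fd_red : forall a, a <> [::] -> hred G (mt a) = m (map (hred G) a)
}.

Record filtration (R : pzRingType) (A : lmodType R) := Filtration {
  fil :> int -> submod A;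
  filP : forall p x, fil (p + 1) x -> fil p x
}.

Record filtered_ainf (R : pzRingType) (A : lmodType R) (gr : int -> A -> Prop)
    (F : filtration A) (m : seq A -> A) (e : option A) : Prop := {
  fil_ainf : ainf_algebra gr m e;
  fil_graded : forall p x, F p x -> gsum (fun=> True) (fun n y => F p y /\ gr n y) x;
  fil_mul : forall d a, a <> [::] -> lies_in (fun p => F p) d a ->
    F (\sum_(i <- d) i) (m a);
  fil_unit : forall u, e = Some u -> F 0 u;
  fil_exhaustive : forall x, exists p, F p x;
  (* graded completeness: in each degree [n], the map from [A^n] to the limit
     of the [A^n / F^q A^n] is injective and surjective *)
  fil_separated : forall n x, gr n x -> (forall q, F q x) -> x = 0;
  fil_complete : forall n (x : int -> A), (forall q, gr n (x q)) ->
    (forall q q', q <= q' -> F q (x q' - x q)) ->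
    exists2 y, gr n y & forall q, F q (y - x q)
}.

Section Rees.
Variables (k : comNzRingType) (A : lmodType k) (F : filtration A).

(* The family [u] stands for the sum of the [u p \otimes hbar^(-p)]. *)
Definition rees_spec (u : int -> A) : Prop :=
  (forall p, F p (u p)) /\ finite_set [set p | u p <> 0].

Definition rees_pred : {pred (int -> A)} := fun u => `[< rees_spec u >].

Fact rees_submod_closed : submod_closed rees_pred.
Proof.
split=> [|c f g /asboolP[f1 f2] /asboolP[g1 g2]]; apply/asboolP; split.
- by move=> p; exact: submod0.
- rewrite (_ : [set _ | _] = set0) //; apply/seteqP; split=> // p /=; exact.
- by move=> p; exact: submodL.
- apply: (@sub_finite_set _ _ ([set p | f p <> 0] `|` [set p | g p <> 0]));
    last by rewrite finite_setU.
  move=> p /= h; apply: contrapT => /not_orP[/contrapT fE /contrapT gE].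
  apply: h; rewrite [LHS]/(c *: f p + g p) fE gE scaler0; exact: addr0.
Qed.

HB.instance Definition _ :=
  GRing.isSubmodClosed.Build k (int -> A) rees_pred rees_submod_closed.

Record reesk : Type := ReesK { rval : int -> A; rvalP : rval \in rees_pred }.

HB.instance Definition _ := [isSub for rval].
HB.instance Definition _ := [Choice of reesk by <:].
HB.instance Definition _ := [SubChoice_isSubLmodule of reesk by <:].

Fact rshift_mem (u : reesk) : (fun p => rval u (p + 1)) \in rees_pred.
Proof.
case: u => u /= /asboolP[u1 u2]; apply/asboolP; split=> [p|].
  exact/filP/u1.
apply: (@sub_finite_set _ _ [set p - 1 | p in [set p | u p <> 0]]);
  last exact: finite_image.
by move=> p /= h; exists (p + 1) => //; rewrite addrK.
Qed.

Definition rshift (u : reesk) : reesk := ReesK (rshift_mem u).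

Fact rshift_linear : linear rshift.
Proof. by move=> c u v; apply/val_inj/funext. Qed.

HB.instance Definition _ := GRing.isLinear.Build k reesk reesk _ rshift
  rshift_linear.

Definition rees : Type := polymod rshift.
HB.instance Definition _ := GRing.Lmodule.copy rees (polymod rshift).

(* The element [x \otimes hbar^(-p)], for [x] in [F p]. *)
Definition rmono (p : int) (x : A) : rees :=
  insubd (0 : reesk) (fun p' => if p' == p then x else 0).

Lemma rmonoE p x : F p x -> rval (rmono p x) = fun p' => if p' == p then x else 0.
Proof.
move=> Fx; rewrite [LHS]val_insubd ifT //; apply/asboolP; split=> [p'|].
  by case: eqP => [->//|_]; exact: submod0.
apply: (sub_finite_set _ (finite_set1 p)) => p' /=; case: eqP => // _; exact.
Qed.

Section Structure.
Variables (gr : int -> submod A) (m : seq A -> A) (e : option A).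

Definition rees_gr (pq : int * int) : rees -> Prop :=
  fun u => gr (pq.1 + pq.2) (rval u pq.1) /\
           forall p, p <> pq.1 -> rval u p = 0.

Fact rees_gr_lin_closed pq : lin_closed (rees_gr pq : reesk -> Prop).
Proof.
split=> [|c u v [u1 u2] [v1 v2]]; first by split=> //; exact: submod0.
split=> [|p hp]; first exact: submodL.
rewrite [LHS]/(c *: rval u p + rval v p) u2 // v2 // scaler0; exact: addr0.
Qed.

Definition rees_gr_submod pq : submod reesk := Submod (rees_gr_lin_closed pq).

(* The coefficient of [hbar^(-p)] in [m (u_1, ..., u_n)] is the sum of the
   [m (u_1 p_1, ..., u_n p_n)] over the [p_1, ..., p_n] of sum [p].  For a
   filtered A-infinity algebra these coefficients do form an element of [rees],
   so that the default value of [insubd] is not used; the same holds for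
   [rees_series] below. *)
Definition rees_op (us : seq rees) : rees :=
  insubd (0 : reesk) (fun p =>
    \sum_(ps \in [set ps : seq int | size ps = size us /\ \sum_(i <- ps) i = p])
      m [seq rval up.1 up.2 | up <- zip us ps]).

Definition rees_unit : option rees := omap (rmono 0) e.

(* The associated graded, i.e. the direct sum of the [F p / F (p + 1)]. *)
Fact gr_ker_lin_closed : lin_closed (fun u : reesk => forall p, F (p + 1) (rval u p)).
Proof.
split=> [p|c u v hu hv p]; first exact: submod0.
by apply: submodL; [exact: hu | exact: hv].
Qed.

Definition gr_ker : submod reesk := Submod gr_ker_lin_closed.

Definition assoc_gr : Type := quotm gr_ker.
HB.instance Definition _ := GRing.Lmodule.copy assoc_gr (quotm gr_ker).

Definition gr_class (p : int) (x : A) : assoc_gr := qpi gr_ker (rmono p x).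

Definition gr_gr (pq : int * int) : submod assoc_gr :=
  qimage_submod gr_ker (rees_gr_submod pq).

Definition gr_op : seq assoc_gr -> assoc_gr := qop gr_ker rees_op.

Definition gr_unit : option assoc_gr := omap (gr_class 0) e.

End Structure.
End Rees.

Arguments rees_gr {k A} F gr pq _.
Arguments rees_op {k A} F m us.
Arguments rees_unit {k A} F e.
Arguments gr_class {k A} F p x.
Arguments gr_gr {k A} F gr pq.
Arguments gr_op {k A} F m _.
Arguments gr_unit {k A} F e.

Section ReesDeformation.
Variables (k : comNzRingType) (A : lmodType k) (gr : int -> submod A).
Variables (F : filtration A) (e : option A) (X : int -> submod A).

(* Graded complements of [F (p + 1)] in [F p].  In the unitary case [1_A] is
   required to lie in [X 0]: otherwise its image in [Gr A [[hbar]]] would not be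
   the unit [1 \otimes 1] prescribed for a unitary formal deformation. *)
Record graded_complements : Prop := {
  compl_graded : forall p x, X p x -> gsum (fun=> True) (fun n y => X p y /\ gr n y) x;
  compl_sum : forall p x,
    F p x <-> exists y z, [/\ X p y, F (p + 1) z & x = y + z];
  compl_direct : forall p x, X p x -> F (p + 1) x -> x = 0;
  compl_unit : forall u, e = Some u -> X 0 u
}.

(* [compl_proj p r] is the projection of [F p] onto [X (p + r)] along the
   other summands of [X p + ... + X (p + r) + F (p + r + 1)]. *)
Definition compl_head (p : int) (x : A) : A :=
  xget 0 [set y | X p y /\ F (p + 1) (x - y)].

Fixpoint compl_proj (p : int) (r : nat) (x : A) : A :=
  if r is r'.+1 then compl_proj (p + 1) r' (x - compl_head p x)
  else compl_head p x.

(* [x hbar^(-p)] with [x] in [F p] of degree [n] is sent to the series of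
   bidegree [(p, n - p)] whose coefficient of [hbar^r] is the class of
   [compl_proj p r x] in [F (p + r) / F (p + r + 1)]. *)
Definition rees_series (u : rees F) : hser (gr_gr F gr) :=
  insubd (0 : hserk (gr_gr F gr)) (fun pq r =>
    gr_class F (pq.1 + r%:Z)
      (component (fun n => gr n) (pq.1 + pq.2)
         (compl_proj pq.1 r (rval u pq.1)))).

End ReesDeformation.

Definition transport (S T : choiceType) (t0 : S) (f : S -> T)
    (m : seq S -> S) : seq T -> T :=
  fun a => f (m (map (fun y => xget t0 [set x | f x = y]) a)).

Section Specialization.
Variables (k : comNzRingType) (B : lmodType k) (G : int * int -> submod B).
Variables (mt : seq (hser G) -> hser G) (e : option B).

Definition hbar1 : submod (hserk G) := hbar_submod (@hshift k B G) ('X - 1).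

Definition Bbar : Type := quotm hbar1.
HB.instance Definition _ := GRing.Lmodule.copy Bbar (quotm hbar1).

Definition Bbar_class (x : hser G) : Bbar := qpi hbar1 x.

Definition Bbar_gr (n : int) : submod Bbar :=
  qimage_submod hbar1 (total_submod (hser_gr_submod G) n).

Definition Bbar_op : seq Bbar -> Bbar := qop hbar1 mt.

Definition Bbar_unit : option Bbar := omap (fun u => Bbar_class (hunit G u)) e.

(* The degree [n] part of the graded completion of [B]. *)
Record gcompl (n : int) : Type := GCompl {
  gcoef :> int -> B;
  gcoef_mem : forall p, G (p, n - p) (gcoef p);
  gcoef_bound : exists p0, forall p, p < p0 -> gcoef p = 0
}.

Definition valuation n (b : gcompl n) : int :=
  xget 0 [set p | b p <> 0 /\ forall p', p' < p -> b p' = 0].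

(* If [b = 0], the value of [valuation b] does not matter and [iota' b] is the
   class of the zero series. *)
Definition iota' n (b : gcompl n) : Bbar :=
  Bbar_class (hmono G (valuation b, n - valuation b)
                      (fun r => b (valuation b + r%:Z))).

Definition gcompl_fil n (p : int) (b : gcompl n) : Prop :=
  forall p', p' < p -> b p' = 0.

Definition Bbar_fil_deg (p n : int) (x : Bbar) : Prop :=
  exists2 b : gcompl n, gcompl_fil p b & x = iota' b.

Fact gcompl_scale_mem n c (b : gcompl n) p : G (p, n - p) (c *: b p).
Proof. exact/submodZ/gcoef_mem. Qed.

Fact gcompl_scale_bound n c (b : gcompl n) :
  exists p0, forall p, p < p0 -> c *: b p = 0.
Proof. by have [p0 h] := gcoef_bound b; exists p0 => p /h->; rewrite scaler0. Qed.

Definition gcompl_scale n (c : k) (b : gcompl n) : gcompl n :=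
  GCompl (gcompl_scale_mem c b) (gcompl_scale_bound c b).

End Specialization.

Section BbarFiltration.
Variables (k : fieldType) (B : lmodType k) (G : int * int -> submod B).

Lemma iota'Z n c (b : gcompl G n) : iota' (gcompl_scale c b) = c *: iota' b.
Proof.
have Gb p (d : gcompl G n) r :
    G ((p, n - p).1 + r%:Z, (p, n - p).2 - r%:Z) (d (p + r%:Z)).
  by rewrite /= -addrA -opprD; exact: gcoef_mem.
have [->|c0] := eqVneq c 0.
  rewrite scale0r /iota' /Bbar_class -(qpi0 (hbar1 G)); congr (qpi _ _).
  apply/val_inj; rewrite /= hmonoE; last by move=> r; exact/submodZ/Gb.
  by do 2!apply/funext => ?; rewrite /= scale0r if_same.
have vE : valuation (gcompl_scale c b) = valuation b.
  rewrite /valuation; congr (xget _ _); apply/seteqP.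
  have E p : (c *: b p = 0) <-> (b p = 0).
    split=> [/eqP|->]; last exact: scaler0.
    by rewrite scaler_eq0 (negPf c0) => /eqP.
  by split=> p /= [h1 h2]; split=> [/E//|p' /h2 /E].
rewrite /iota' vE /Bbar_class -[RHS]/(qscale _ _) qpiZ; congr (qpi _ _); apply/val_inj.
rewrite /= hmonoE; last by move=> r; exact/submodZ/Gb.
do 2!apply/funext => ?.
rewrite [RHS]/(c *: hval (hmono _ _ _) _ _) hmonoE; last exact: Gb.
by case: eqP => // _; apply/esym; exact: scaler0.
Qed.

Fact Bbar_fil_lin_closed p :
  lin_closed (gsum (fun=> True) (@Bbar_fil_deg k B G p)).
Proof.
apply: gsum_lin_closed => n c _ [b hb ->]; exists (gcompl_scale c b).
  by move=> p' hp'; rewrite /= hb // scaler0.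
by rewrite iota'Z.
Qed.

Fact Bbar_fil_dec p (x : Bbar G) :
  gsum (fun=> True) (@Bbar_fil_deg k B G (p + 1)) x ->
  gsum (fun=> True) (@Bbar_fil_deg k B G p) x.
Proof.
move=> [s hs ->]; exists s => // z /hs[_ [b hb bE]]; split=> //.
exists b => // p' hp'; apply: hb; apply: lt_trans hp' _.
by rewrite ltrDl.
Qed.

(* [F p] is the sum over [n] of the [iota' (F p of the degree n part)]. *)
Definition Bbar_fil : filtration (Bbar G) :=
  @Filtration _ (Bbar G) (fun p => Submod (Bbar_fil_lin_closed p)) Bbar_fil_dec.

End BbarFiltration.

(* Main.v *)
From mathcomp Require Import all_boot all_order all_algebra.
From mathcomp Require Import boolp classical_sets functions.
From mathcomp Require Import cardinality fsbigop zify.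
Require Import Defs.

(** Setting hbar to 1 loses nothing, because the series over [B] form a
    hbar-torsion-free module graded by the first degree, in which hbar lowers
    that degree by one.  Call the part of first degree [p], all second degrees
    together, the row [p].  The class map to the quotient by (hbar - 1)
    identifies row [p] with the step [F p] of the filtration, and under these
    identifications multiplication by hbar from row [p + 1] to row [p] is the
    inclusion of [F (p + 1)] in [F p].  Summing over [p] recovers the whole
    deformation as the Rees module, and since the operations add first degrees
    this identification is a strict isomorphism.

    To make this computable, an element of the quotient is described by its
    coefficients.  The map [ev] adds up the coefficients of a series that lie in
    the same [B^(p,q)]; its kernel is exactly the multiples of hbar - 1
    ([ev_ker]), so it induces injective coefficients [bcoef] on the quotient, and
    every family that is bounded below and supported in finitely many total
    degrees occurs ([bfamily]).  The filtration and the grading become vanishing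
    conditions on coefficients ([Bbar_filP], [Bbar_grP]), and separatedness and
    completeness are then read off.

    The A-infinity relations of the deformation are known only modulo all powers
    of hbar, but no nonzero series is divisible by all of them, so they hold
    exactly ([mt_relation]); they then pass to the quotient and, along the
    isomorphism [hser_to_rees], to the Rees algebra.  The identification
    [symbol] of the associated graded with [B] is the reduction modulo hbar read
    through that isomorphism.

    For the last claim, a choice of complements gives a map [theta] from the Rees
    module to the series.  Composing it with [hser_to_rees] yields an
    endomorphism of the series that is linear over k[hbar], respects the bidegrees
    and is the identity modulo hbar: the complements change a coefficient only
    by later steps of the filtration.  Such a map is bijective by successive
    approximation in powers of hbar ([id_mod_hbar_surj]), so [theta] is bijective
    as well, and this composite is the required isomorphism between the two
    deformations. *)

Set Implicit Arguments.
Unset Strict Implicit.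
Unset Printing Implicit Defensive.

Import Order.TTheory GRing.Theory Num.Theory.
Local Open Scope ring_scope.

(** * Additive maps, multilinear operations and transport of structure *)

Lemma inj_surj_bij (A B : zmodType) (f : A -> B) :
  injective f -> (forall y, exists x, f x = y) -> bijective f.
Proof.
move=> fI fS; exists (fun y => xget 0 [set x | f x = y]%classic).
  by move=> x; apply: fI; case: xgetP => [z _ //|/(_ x)/=]; case.
by move=> y; case: xgetP => [z _ //|]; have [x <-] := fS y => /(_ x)/=; case.
Qed.

Section AdditiveFunctions.
Variables (A B : zmodType) (f : A -> B).
Hypothesis fD : forall x y, f (x + y) = f x + f y.

Lemma addf0 : f 0 = 0.
Proof. by apply: (addrI (f 0)); rewrite -fD !addr0. Qed.

Lemma addfN x : f (- x) = - f x.
Proof. by apply: (addrI (f x)); rewrite -fD !subrr addf0. Qed.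

Lemma addfB x y : f (x - y) = f x - f y.
Proof. by rewrite fD addfN. Qed.

Lemma addf_sum (I : Type) (s : seq I) (P : pred I) (F : I -> A) :
  f (\sum_(i <- s | P i) F i) = \sum_(i <- s | P i) f (F i).
Proof. exact: (big_morph f fD addf0). Qed.

End AdditiveFunctions.

Lemma linear_addf (R : pzRingType) (A B : lmodType R) (f : A -> B) :
  (forall c x y, f (c *: x + y) = c *: f x + f y) ->
  forall x y, f (x + y) = f x + f y.
Proof. by move=> fL x y; rewrite -[x]scale1r fL !scale1r. Qed.

Lemma linear_scalef (R : pzRingType) (A B : lmodType R) (f : A -> B) :
  (forall c x y, f (c *: x + y) = c *: f x + f y) ->
  forall c x, f (c *: x) = c *: f x.
Proof.
by move=> fL c x; rewrite -[_ *: _]addr0 fL (addf0 (linear_addf fL)) addr0.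
Qed.

Lemma sign_scale (R : pzRingType) (A : lmodType R) n (x : A) :
  (-1) ^+ n *: x = if odd n then - x else x.
Proof. by rewrite -signr_odd; case: odd; rewrite ?scaleN1r ?scale1r. Qed.

(** Additivity is enough, and the two modules may live over different rings: the
    only scalars in the Stasheff sum are signs, which every additive map
    respects.  This lets the relation travel along reductions modulo powers of
    hbar and along the specialization at hbar = 1, which change the base ring. *)
Lemma stasheff_morph (R R' : pzRingType) (A : lmodType R) (A' : lmodType R')
    (f : A -> A') m m' d a :
  (forall x y, f (x + y) = f x + f y) ->
  (forall a, a <> [::] -> f (m a) = m' (map f a)) ->
  f (stasheff m d a) = stasheff m' d (map f a).
Proof.
move=> fD fm; rewrite /stasheff size_map (addf_sum fD).
rewrite !big_nat; apply: eq_bigr => r /andP[_ hr]; rewrite (addf_sum fD).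
rewrite !big_nat; apply: eq_bigr => s /andP[s0 hs].
rewrite !sign_scale -map_take -map_drop -map_take -map_drop.
have fin : f (m (take s (drop r a))) = m' (map f (take s (drop r a))).
  apply: fm; move/(congr1 size); rewrite size_take size_drop /=.
  by case: ltnP; move: hr hs s0; lia.
have fout : f (m (take r a ++ m (take s (drop r a)) :: drop (r + s) a)) =
    m' (map f (take r a) ++ m' (map f (take s (drop r a))) :: map f (drop (r + s) a)).
  by rewrite fm; [rewrite map_cat /= fin | case: (take r a)].
by rewrite -fout; case: odd => //; rewrite (addfN fD).
Qed.

Section Multilinear.
Variables (R : pzRingType) (A B : lmodType R).
Implicit Types (m : seq A -> B).

Lemma multilinearD m a b x y : multilinear m ->
  m (a ++ x + y :: b) = m (a ++ x :: b) + m (a ++ y :: b).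
Proof. by move=> ml; rewrite -[x]scale1r ml !scale1r. Qed.

Lemma multilinear0 m a b : multilinear m -> m (a ++ 0 :: b) = 0.
Proof. by move=> ml; apply: (@addf0 _ _ (fun x => m (a ++ x :: b))) => x y; exact: multilinearD. Qed.

Lemma multilinearZ m a b c x : multilinear m -> m (a ++ c *: x :: b) = c *: m (a ++ x :: b).
Proof. by move=> ml; rewrite -[c *: x]addr0 ml multilinear0 // addr0. Qed.

Lemma multilinear_sum m a b (I : Type) (s : seq I) (F : I -> A) : multilinear m ->
  m (a ++ \sum_(i <- s) F i :: b) = \sum_(i <- s) m (a ++ F i :: b).
Proof.
by move=> ml; rewrite (@addf_sum _ _ (fun x => m (a ++ x :: b))) // => x y; exact: multilinearD.
Qed.

Lemma multilinear_cons m x : multilinear m -> multilinear (fun b => m (x :: b)).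
Proof. by move=> ml a b c y z; rewrite -!cat_cons ml. Qed.

End Multilinear.

Lemma lies_in_cons (I M : zmodType) (G : I -> M -> Prop) i d x a :
  lies_in G (i :: d) (x :: a) <-> G i x /\ lies_in G d a.
Proof.
split=> [[/= [sz] h]|[h0 [sz h]]].
  by split; [exact: (h 0%N) | split=> // j hj; exact: (h j.+1)].
by split=> /= [|[|j] hj //]; [rewrite sz | exact: h].
Qed.

Lemma lies_in_map (I M N : zmodType) (G : I -> M -> Prop) (G' : I -> N -> Prop)
    (f : M -> N) d a : (forall i x, G i x -> G' i (f x)) ->
  lies_in G d a -> lies_in G' d (map f a).
Proof.
move=> h; elim: a d => [|x a IH] [|i d] //=; try by case.
by move=> /lies_in_cons[/h hx /IH ha]; exact/lies_in_cons.
Qed.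

Lemma lies_in_lift (I M N : zmodType) (G : I -> M -> Prop) (G' : I -> N -> Prop)
    (f : M -> N) d b : (forall i y, G' i y -> exists2 x, G i x & y = f x) ->
  lies_in G' d b -> exists2 a, lies_in G d a & b = map f a.
Proof.
move=> h; elim: b d => [|y b IH] [|i d] //=; try by case.
  by move=> _; exists [::].
move=> /lies_in_cons[/h[x Gx ->] /IH[a ha ->]].
by exists (x :: a) => //; exact/lies_in_cons.
Qed.

(** Used with [h] the total degree or the first degree: an operation known to
    be bihomogeneous is homogeneous for every coarser grading, because expanding
    by multilinearity reduces to arguments that are bihomogeneous. *)
Lemma multilinear_gsum (R : pzRingType) (A B : lmodType R) (I J : zmodType)
    (h : I -> J) (G : I -> A -> Prop) (Q : B -> Prop) (m : seq A -> B) e a :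
  (forall i i', h (i + i') = h i + h i') ->
  multilinear m -> Q 0 -> (forall x y, Q x -> Q y -> Q (x + y)) ->
  lies_in (fun j => gsum (fun i => h i = j) G) e a ->
  (forall d b, size b = size a -> lies_in G d b ->
     h (\sum_(i <- d) i) = \sum_(i <- e) i -> Q (m b)) ->
  Q (m a).
Proof.
move=> hD + Q0 QD; elim: a e m => [|x a IH] [|j e] m ml //; try by case.
  by move=> _ hQ; apply: (hQ [::]) => //; rewrite !big_nil (addf0 hD).
move=> /lies_in_cons[[s hs ->] ha] hQ.
rewrite -[_ :: a]cat0s multilinear_sum // big_seq; elim/big_ind: _ => // z /hs[zj Gz].
apply: (IH e (fun b => m (z.2 :: b)) (multilinear_cons _ ml) ha) => d b sz hd E.
apply: (hQ (z.1 :: d)) => /=; first by rewrite sz.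
  exact/lies_in_cons.
by rewrite !big_cons hD E zj.
Qed.

(** The words of length [n] in the letters [s] index the terms of the expansion
    of an [n]-ary operation whose arguments are sums over [s]. *)
Fixpoint words (J : Type) (s : seq J) (n : nat) : seq (seq J) :=
  if n is n'.+1 then [seq j :: w | j <- s, w <- words s n'] else [:: [::]].

Lemma words_uniq (J : eqType) (s : seq J) n : uniq s -> uniq (words s n).
Proof.
move=> us; elim: n => //= n IH; apply: allpairs_uniq => //.
by move=> [i v] [j w] _ _ /= [-> ->].
Qed.

Lemma wordsP (J : eqType) (s : seq J) n w :
  reflect (size w = n /\ {subset w <= s}) (w \in words s n).
Proof.
elim: n w => [|n IH] w.
  rewrite inE; apply: (iffP eqP) => [->//|[/size0nil//]].
apply: (iffP allpairsP) => [[[j v] [/= hj /IH[sv hv] ->]]|].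
  by split=> [/=|x]; [rewrite sv | rewrite inE => /predU1P[->//|/hv]].
case: w => [|j v] [//= [sv] hv]; exists (j, v); split=> //=.
  by apply: hv; rewrite mem_head.
by apply/IH; split=> // x hx; apply: hv; rewrite inE hx orbT.
Qed.

Lemma multilinear_expand (R : pzRingType) (A B : lmodType R) (J : eqType)
    (s : seq J) (pr : J -> A -> A) (m : seq A -> B) a : multilinear m ->
  (forall x, x \in a -> x = \sum_(j <- s) pr j x) ->
  m a = \sum_(w <- words s (size a)) m [seq pr up.2 up.1 | up <- zip a w].
Proof.
move=> + ha; elim: a m ha => [|x a IH] m ha ml; first by rewrite big_seq1.
rewrite [in LHS](ha x) ?mem_head // -[_ :: a]cat0s multilinear_sum //= big_allpairs_dep.
apply: eq_bigr => j _; rewrite (IH _ _ (multilinear_cons _ ml)) // => y hy.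
by apply: ha; rewrite inE hy orbT.
Qed.

(** The operation on the quotient is defined through chosen representatives; if
    the submodule absorbs the operation then any representatives will do. *)
Lemma qop_qpi (R : pzRingType) (M : lmodType R) (S : submod M) (m : seq M -> M)
    (a : seq M) : multilinear m ->
  (forall a x b, S x -> S (m (a ++ x :: b))) ->
  qop S m (map (qpi S) a) = qpi S (m a).
Proof.
move=> ml mS; rewrite /qop -map_comp; apply/qpiP.
suff h p : S (m (p ++ map (@qrepr _ _ S \o qpi S) a) - m (p ++ a)) by exact: (h [::]).
elim: a p => [|x a IH] p /=; first by rewrite subrr; exact: submod0.
have -> : m (p ++ qrepr (qpi S x) :: map (@qrepr _ _ S \o qpi S) a) =
  m (p ++ qrepr (qpi S x) - x :: map (@qrepr _ _ S \o qpi S) a) +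
  m (rcons p x ++ map (@qrepr _ _ S \o qpi S) a).
  by rewrite cat_rcons -multilinearD // subrK.
rewrite -addrA; apply: submodD; last by rewrite -[p ++ x :: a]cat_rcons; exact: IH.
by apply: mS; apply/qpiP; rewrite qreprK.
Qed.

Lemma map_qreprK (R : pzRingType) (M : lmodType R) (S : submod M) (a : seq (quotm S)) :
  map (qpi S) (map (@qrepr _ _ S) a) = a.
Proof. by rewrite -map_comp map_id_in // => x _; exact: qreprK. Qed.

(** Applying the additive map [pr i] to a relation isolates its component of
    index [i]. *)
Lemma direct_sum_proj (I : eqType) (M : zmodType) (G : I -> M -> Prop)
    (pr : I -> M -> M) :
  (forall i, G i 0) -> (forall i x y, G i x -> G i y -> G i (x - y)) ->
  (forall x, gsum (fun=> True) G x) ->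
  (forall i x y, pr i (x + y) = pr i x + pr i y) ->
  (forall i x, G i x -> pr i x = x) ->
  (forall i j x, G j x -> i <> j -> pr i x = 0) ->
  direct_sum G.
Proof.
move=> G0 GB Gs prD pr1 pr0; split=> // s f us hf E i si.
have := congr1 (pr i) E; rewrite (addf0 (prD i)) (addf_sum (prD i)).
rewrite (bigD1_seq i) //= (pr1 i) //; last exact: hf.
rewrite big_seq_cond big1 ?addr0 // => j /andP[sj /eqP ji].
by apply: (pr0 _ j); [exact: hf | exact/nesym].
Qed.

Lemma gsum1 (I : eqType) (M : zmodType) (P : I -> Prop) (G : I -> M -> Prop) i x :
  P i -> G i x -> gsum P G x.
Proof.
by move=> Pi Gx; exists [:: (i, x)]; rewrite ?big_seq1 // => z; rewrite inE => /eqP->.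
Qed.

Lemma gsum_sum (I : eqType) (M : zmodType) (P : I -> Prop) (G : I -> M -> Prop)
    (s : seq I) (F : I -> M) :
  (forall i, i \in s -> P i /\ G i (F i)) -> gsum P G (\sum_(i <- s) F i).
Proof.
move=> h; exists [seq (i, F i) | i <- s]; last by rewrite big_map.
by move=> z /mapP[i si ->]; exact: h.
Qed.

Lemma gsum_ind (I : eqType) (M : zmodType) (P : I -> Prop) (G : I -> M -> Prop)
    (Q : M -> Prop) x :
  Q 0 -> (forall x y, Q x -> Q y -> Q (x + y)) ->
  (forall i x, P i -> G i x -> Q x) -> gsum P G x -> Q x.
Proof.
move=> Q0 QD QG [s hs ->]; rewrite big_seq; elim/big_ind: _ => // z /hs[].
exact: QG.
Qed.

Lemma gsum_map (I : eqType) (M N : zmodType) (P : I -> Prop) (G : I -> M -> Prop)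
    (G' : I -> N -> Prop) (f : M -> N) x :
  (forall x y, f (x + y) = f x + f y) ->
  (forall i x, G i x -> G' i (f x)) -> gsum P G x -> gsum P G' (f x).
Proof.
move=> fD fG [s hs ->]; exists [seq (z.1, f z.2) | z <- s].
  by move=> z /mapP[y /hs[Py Gy] ->]; split=> //; exact: fG.
by rewrite big_map (addf_sum fD).
Qed.

Lemma qop_multilinear (R : pzRingType) (M : lmodType R) (S : submod M)
    (m : seq M -> M) : multilinear m ->
  (forall a x b, S x -> S (m (a ++ x :: b))) -> multilinear (qop S m).
Proof.
move=> ml mS a b c x y.
rewrite -[a]map_qreprK -[b]map_qreprK -[x]qreprK -[y]qreprK.
rewrite -[c *: qpi _ _]/(qscale _ _) qpiZ -qpiD.
have mc z : map (qpi S) (map (@qrepr _ _ S) a) ++ qpi S z ::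
    map (qpi S) (map (@qrepr _ _ S) b) =
    map (qpi S) (map (@qrepr _ _ S) a ++ z :: map (@qrepr _ _ S) b).
  by rewrite map_cat.
by rewrite !mc !qop_qpi // ml qpiD -qpiZ.
Qed.

(** The lift has to contain the prescribed element [x] itself, not merely another
    preimage of [f x]: this is what carries unitality over to an image. *)
Lemma map_lift_mem (A B : eqType) (f : A -> B) (x : A) (b : seq B) :
  (forall y, exists x, f x = y) -> f x \in b -> exists2 a, x \in a & b = map f a.
Proof.
move=> fS; have lift c : exists a, c = map f a.
  elim: c => [|y c [a ->]]; first by exists [::].
  by have [z <-] := fS y; exists (z :: a).
elim: b => // y b IH; rewrite inE => /predU1P[<-|/IH[a xa ->]].
  by have [a ->] := lift b; exists (x :: a); rewrite ?mem_head.
by have [z <-] := fS y; exists (z :: a); rewrite // inE xa orbT.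
Qed.

(** An A-infinity structure passes to any surjective image in which the
    homogeneous elements lift.  This covers quotients and isomorphisms alike; the
    hypotheses on [gr'] and [m'] do not follow from those on [gr] and [m], since a
    quotient may destroy the direct sum and the base ring may change. *)
Lemma ainf_image (R R' : pzRingType) (A : lmodType R) (A' : lmodType R')
    (f : A -> A') (gr : int -> A -> Prop) (gr' : int -> A' -> Prop)
    (m : seq A -> A) (m' : seq A' -> A') (e : option A) (e' : option A') :
  (forall x y, f (x + y) = f x + f y) ->
  (forall y, exists x, f x = y) ->
  (forall n y, gr' n y <-> exists2 x, gr n x & y = f x) ->
  (forall a, a <> [::] -> f (m a) = m' (map f a)) ->
  omap f e = e' ->
  direct_sum gr' -> (forall n c x, gr' n x -> gr' n (c *: x)) ->
  multilinear m' ->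
  ainf_algebra gr m e -> ainf_algebra gr' m' e'.
Proof.
move=> fD fS fgr fm fe Hd' Hs' Hl' [_ _ _ Hg Hr Hu].
have lift d a : a <> [::] -> lies_in gr' d a ->
    exists b, [/\ b <> [::], lies_in gr d b & a = map f b].
  move=> a0 ha; have [b hb E] : exists2 b, lies_in gr d b & a = map f b.
    by apply: lies_in_lift ha => n y /fgr.
  by exists b; split=> // b0; rewrite E b0 in a0.
split=> //.
- move=> d a a0 ha; have [b [b0 hb ->]] := lift d a a0 ha.
  by rewrite size_map -fm //; apply/fgr; exists (m b) => //; exact: Hg.
- move=> d a a0 ha; have [b [b0 hb ->]] := lift d a a0 ha.
  by rewrite -(stasheff_morph _ _ fD fm) Hr ?(addf0 fD).
- move=> u; rewrite -fe; case: e Hu {fe} => //= v Hu [<-].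
  have [g0 [u1 u2 u3]] := Hu _ erefl; split; first by apply/fgr; exists v.
  split=> [y|y|a va sa].
  + by have [x <-] := fS y; rewrite -[[:: _; _]]/(map f [:: v; x]) -fm // u1.
  + by have [x <-] := fS y; rewrite -[[:: _; _]]/(map f [:: x; v]) -fm // u2.
  + have [b vb E] := map_lift_mem fS va.
    rewrite E -fm; first by rewrite u3 ?(addf0 fD) // -(size_map f b) -E.
    by case: (b) vb.
Qed.

Section Transport.
Variables (R : pzRingType) (A A' : lmodType R) (f : A -> A').
Hypothesis f_lin : forall c x y, f (c *: x + y) = c *: f x + f y.
Hypothesis f_bij : bijective f.

Let fD := linear_addf f_lin.

Lemma gsum_transport (I : eqType) (P : I -> Prop) (G : I -> A -> Prop) (G' : I -> A' -> Prop) x :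
  (forall i x, G' i (f x) <-> G i x) ->
  gsum P G' (f x) <-> gsum P G x.
Proof.
move=> fG; case: f_bij => g fK gK; split; last first.
  by apply: gsum_map => // i y /fG.
have gD x' y' : g (x' + y') = g x' + g y'.
  by apply: (can_inj fK); rewrite fD !gK.
rewrite -{2}[x]fK; apply: gsum_map => // i y Gy; apply/fG; by rewrite gK.
Qed.

Lemma direct_sum_transport (I : eqType) (G : I -> A -> Prop) (G' : I -> A' -> Prop) :
  (forall i x, G' i (f x) <-> G i x) -> direct_sum G -> direct_sum G'.
Proof.
move=> fG [G0 GB Gs Gf]; case: (f_bij) => g fK gK.
have gD x' y' : g (x' + y') = g x' + g y'.
  by apply: (can_inj fK); rewrite fD !gK.
have gG i y : G' i y <-> G i (g y) by rewrite -{1}[y]gK fG.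
split.
- by move=> i; apply/gG; rewrite (addf0 gD).
- by move=> i x y /gG hx /gG hy; apply/gG; rewrite (addfB gD); exact: GB.
- by move=> x; rewrite -[x]gK; exact/gsum_transport.
- move=> s F us hF E i si; rewrite -[F i]gK (_ : g (F i) = 0) ?(addf0 fD) //.
  apply: (Gf s (g \o F)) => // [j sj|]; first exact/gG/hF.
  by rewrite /= -(addf_sum gD) E (addf0 gD).
Qed.

Variables (m : seq A -> A) (m' : seq A' -> A') (e : option A) (e' : option A').
Hypothesis fm : forall a, a <> [::] -> f (m a) = m' (map f a).
Hypothesis fe : omap f e = e'.

Lemma multilinear_transport : multilinear m -> multilinear m'.
Proof.
move=> ml a b c x y; case: f_bij => g fK gK.
have gE l : m' l = m' (map f (map g l)) by rewrite -map_comp map_id_in // => z _ /=.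
have catN (l l' : seq A) z : l ++ z :: l' <> [::] by case: l.
have gE' l z l' : m' (l ++ z :: l') = f (m (map g l ++ g z :: map g l')).
  by rewrite gE fm // map_cat.
rewrite !gE' -f_lin -ml; congr (f (m (_ ++ _ :: _))).
by apply: (can_inj fK); rewrite f_lin !gK.
Qed.

Lemma degree_transport (I : zmodType) (D : nat -> I) (G : I -> A -> Prop) (G' : I -> A' -> Prop) :
  (forall i x, G' i (f x) <-> G i x) ->
  (forall d a, a <> [::] -> lies_in G d a -> G (\sum_(i <- d) i + D (size a)) (m a)) ->
  (forall d a, a <> [::] -> lies_in G' d a -> G' (\sum_(i <- d) i + D (size a)) (m' a)).
Proof.
move=> fG h d a a0 ha; case: f_bij => g fK gK.
have [b hb E] : exists2 b, lies_in G d b & a = map f b.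
  by apply: lies_in_lift ha => i y Gy; exists (g y); rewrite ?gK //; apply/fG; rewrite gK.
rewrite E in a0 *; have b0 : b <> [::] by move=> b0; rewrite b0 in a0.
by rewrite size_map -fm //; apply/fG/h.
Qed.

Lemma ainf_transport (gr : int -> A -> Prop) (gr' : int -> A' -> Prop) :
  (forall i x, gr' i (f x) <-> gr i x) ->
  ainf_algebra gr m e -> ainf_algebra gr' m' e'.
Proof.
move=> fG Ha; have [Hd Hs Hl _ _ _] := Ha; case: (f_bij) => g fK gK.
have gG i y : gr' i y <-> gr i (g y) by rewrite -{1}[y]gK fG.
(* A bijective map is in particular surjective, and its inverse gives the
   lifts of homogeneous elements. *)
apply: (ainf_image fD _ _ fm fe _ _ _ Ha).
- by move=> y; exists (g y).
- move=> n y; split=> [/gG hy|[x hx ->]]; last exact/fG.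
  by exists (g y).
- exact: (direct_sum_transport fG).
- by move=> n c x; rewrite -[x]gK -(linear_scalef f_lin) !fG; exact: Hs.
- exact: multilinear_transport.
Qed.

Lemma bigraded_transport (RG : int * int -> R -> Prop)
    (G : int * int -> A -> Prop) (G' : int * int -> A' -> Prop) :
  (forall i x, G' i (f x) <-> G i x) ->
  bigraded_ainf RG G m e -> bigraded_ainf RG G' m' e'.
Proof.
move=> fG [Ha Hd Hs Hg Hu]; case: (f_bij) => g fK gK; split.
- by apply: (ainf_transport _ Ha) => n x; exact: gsum_transport.
- exact: (direct_sum_transport fG).
- by move=> i j c x hc; rewrite -[x]gK -(linear_scalef f_lin) !fG; exact: Hs.
- exact: (@degree_transport _ (fun n => (0, 2 - n%:Z))).
- by move=> u; rewrite -fe; case: e Hu => //= v Hu [<-]; exact/fG/Hu.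
Qed.

End Transport.

(** * Formal series over a bigraded module *)

(** By Horner's rule the action of a polynomial is built from scalars and from
    hbar. *)
Lemma polymod_linear (k : comNzRingType) (V W : lmodType k)
    (phi : {linear V -> V}) (psi : {linear W -> W})
    (f : polymod phi -> polymod psi) :
  (forall c (x y : V), f (c *: x + y : V) = (c *: (f x : W) + (f y : W) : W)) ->
  (forall x : polymod phi, f ('X *: x) = 'X *: f x) ->
  forall (c : {poly k}) x y, f (c *: x + y) = c *: f x + f y.
Proof.
move=> fL fX c x y; have fD := @linear_addf k V W f fL; have fZ := @linear_scalef k V W f fL.
rewrite [LHS]fD; congr (_ + _); elim/poly_ind: c => [|p c IH].
  by rewrite !scale0r; exact: (addf0 fD).
rewrite !scalerDl [LHS]fD !polymodC [in RHS]mulrC -[in RHS]scalerA -IH -fX.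
by rewrite scalerA mulrC; congr (_ + _); exact: fZ.
Qed.

Lemma finite_suppP (T : eqType) (V : zmodType) (F : T -> V) :
  finite_set [set p | F p <> 0]%classic <->
  exists s : seq T, forall p, p \notin s -> F p = 0.
Proof.
split=> [/finite_seqP[s E]|[s hs]].
  exists s => p hp; apply: contrapT => h.
  have : [set` s]%classic p by rewrite -E.
  by rewrite /= (negPf hp).
apply/finite_seqP; exists [seq p <- s | `[< F p <> 0 >]].
apply/seteqP; split=> p /=.
  move=> h; rewrite mem_filter; apply/andP; split; first exact/asboolP.
  by apply: contrapT => /negP/hs.
by rewrite mem_filter => /andP[/asboolP].
Qed.

Lemma fsum_setT (T : choiceType) (V : zmodType) (s : seq T) (F : T -> V) :
  uniq s -> (forall i, i \notin s -> F i = 0) ->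
  \sum_(i \in [set: T]%classic) F i = \sum_(i <- s) F i.
Proof.
move=> us hs; rewrite (@bigfs _ _ _ _ s predT) //; last by move=> i _ /hs.
by rewrite (_ : [set` predT]%classic = setT) //; apply/seteqP; split.
Qed.

Section Series.
Variables (k : comNzRingType) (B : lmodType k) (G : int * int -> submod B).
Implicit Types (f g : hser G) (pq : int * int) (P : pred (int * int)).

Lemma hser_ext f g : (forall pq r, hval f pq r = hval g pq r) -> f = g.
Proof. by move=> h; apply/val_inj; do 2!apply/funext => ?; exact: h. Qed.

Lemma hvalD f g pq r : hval (f + g) pq r = hval f pq r + hval g pq r.
Proof. by []. Qed.
Lemma hvalB f g pq r : hval (f - g) pq r = hval f pq r - hval g pq r.
Proof. by []. Qed.
Lemma hvalC c f pq r : hval (c%:P *: f) pq r = c *: hval f pq r.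
Proof. by rewrite polymodC. Qed.

Lemma hval_sum (I : Type) (s : seq I) (P : pred I) (F : I -> hser G) pq r :
  hval (\sum_(i <- s | P i) F i) pq r = \sum_(i <- s | P i) hval (F i) pq r.
Proof. exact: (@addf_sum _ _ (fun f : hser G => hval f pq r)). Qed.

Lemma hvalX f pq r :
  hval ('X *: f) pq r = if r is r'.+1 then hval f (pq.1 + 1, pq.2 - 1) r' else 0.
Proof. by rewrite polymodX. Qed.

Lemma hvalXn n f pq r : hval ('X^n *: f) pq r =
  if (r < n)%N then 0 else hval f (pq.1 + n%:Z, pq.2 - n%:Z) (r - n).
Proof.
elim: n f pq r => [|n IH] f [p q] r.
  by rewrite expr0 scale1r subn0; congr (hval f (_, _) r) => /=; lia.
rewrite exprS -scalerA hvalX; case: r => [|r] //=.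
rewrite IH ltnS; case: ltnP => // _; rewrite subSS /=.
by congr (hval f (_, _) _); lia.
Qed.

Lemma hserG f pq r : G (pq.1 + r%:Z, pq.2 - r%:Z) (hval f pq r).
Proof. by case: f => f /= /asboolP[]. Qed.

Lemma hsupp f : exists s : seq (int * int), forall pq r, pq \notin s -> hval f pq r = 0.
Proof.
case: f => f /= /asboolP[_ /finite_suppP[s hs]]; exists s => pq r hpq.
by rewrite hs.
Qed.

(** A series from its coefficients; [insubd] returns 0 on families that do not
    qualify, so that every use goes through [hmkE]. *)
Definition hmk (F : int * int -> nat -> B) : hser G := insubd (0 : hserk G) F.

Lemma hmkE F : (forall pq r, G (pq.1 + r%:Z, pq.2 - r%:Z) (F pq r)) ->
  (exists s : seq (int * int), forall pq r, pq \notin s -> F pq r = 0) ->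
  hval (hmk F) = F.
Proof.
move=> FG [s hs]; rewrite [LHS]val_insubd ifT //; apply/asboolP; split=> //.
by apply/finite_suppP; exists s => pq hpq; apply/funext => r; exact: hs.
Qed.

Definition hres (P : pred (int * int)) f : hser G :=
  hmk (fun pq r => if P pq then hval f pq r else 0).

Lemma hresE P f pq r : hval (hres P f) pq r = if P pq then hval f pq r else 0.
Proof.
rewrite hmkE // => [pq' r'|]; first by case: ifP => _; [exact: hserG|exact: submod0].
by have [s hs] := hsupp f; exists s => pq' r' /hs->; rewrite if_same.
Qed.

Lemma hresD P f g : hres P (f + g) = hres P f + hres P g.
Proof.
by apply: hser_ext => pq r; rewrite hvalD !hresE; case: ifP; rewrite ?addr0.
Qed.

Lemma hres_id P f : (forall pq r, ~~ P pq -> hval f pq r = 0) -> hres P f = f.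
Proof.
by move=> h; apply: hser_ext => pq r; rewrite hresE; case: ifPn => // /h.
Qed.

Lemma hres_eq0 P f : (forall pq r, P pq -> hval f pq r = 0) -> hres P f = 0.
Proof.
by move=> h; apply: hser_ext => pq r; rewrite hresE; case: ifP => // /h.
Qed.

Lemma hser_grP pq f :
  hser_gr G pq f <-> forall pq' r, pq' <> pq -> hval f pq' r = 0.
Proof.
split=> h pq'; first by move=> r /h->.
by move=> hpq; apply/funext => r; exact: h.
Qed.

Lemma hres1_gr pq f : hser_gr G pq (hres (pred1 pq) f).
Proof. by apply/hser_grP => pq' r /eqP h; rewrite hresE /= (negPf h). Qed.

Lemma hres1_sum (s : seq (int * int)) f : uniq s ->
  (forall pq r, pq \notin s -> hval f pq r = 0) ->
  f = \sum_(pq <- s) hres (pred1 pq) f.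
Proof.
move=> us hs; apply: hser_ext => pq r; rewrite hval_sum.
have [spq|spq] := boolP (pq \in s); last first.
  rewrite hs // big_seq big1 // => pq' spq'; rewrite hresE /=.
  by case: eqP => // E; rewrite E spq' in spq.
rewrite (bigD1_seq pq) //= hresE /= eqxx big1 ?addr0 // => pq' npq.
by rewrite hresE /= eq_sym (negPf npq).
Qed.

Lemma hsuppu f : exists2 s : seq (int * int), uniq s &
  forall pq r, pq \notin s -> hval f pq r = 0.
Proof.
have [s hs] := hsupp f; exists (undup s); first exact: undup_uniq.
by move=> pq r; rewrite mem_undup; exact: hs.
Qed.

Lemma hser_gr_span (P : int * int -> Prop) f :
  gsum P (hser_gr G) f <-> forall pq r, ~ P pq -> hval f pq r = 0.
Proof.
split=> [|h].
  apply: (@gsum_ind _ _ _ _ (fun f => forall pq r, ~ P pq -> hval f pq r = 0)) => //.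
    by move=> x y hx hy pq r hpq; rewrite hvalD hx // hy // addr0.
  move=> i x Pi /hser_grP hx pq r hpq; apply: hx => E; by rewrite E in hpq.
have [s us hs] := hsuppu f.
have us' : uniq [seq pq <- s | `[< P pq >]] by rewrite filter_uniq.
rewrite (@hres1_sum _ f us'); last first.
  move=> pq r; rewrite mem_filter negb_and => /orP[/asboolP/h//|]; exact: hs.
apply: gsum_sum => pq; rewrite mem_filter => /andP[/asboolP Pp _].
by split=> //; exact: hres1_gr.
Qed.

Lemma hser_gr_direct : direct_sum (hser_gr G).
Proof.
apply: (@direct_sum_proj _ _ _ (fun pq => hres (pred1 pq))).
- by move=> i; apply/hser_grP.
- move=> i x y /hser_grP hx /hser_grP hy; apply/hser_grP => pq r h.
  by rewrite hvalB hx // hy // subr0.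
- by move=> x; apply/hser_gr_span.
- by move=> i x y; exact: hresD.
- by move=> i x /hser_grP hx; apply: hres_id => pq r /= /eqP; exact: hx.
- by move=> i j x /hser_grP hx ij; apply: hres_eq0 => pq r /= /eqP->; exact: hx.
Qed.

Lemma totalP n f :
  total (hser_gr G) n f <-> forall pq r, pq.1 + pq.2 != n -> hval f pq r = 0.
Proof.
rewrite /total hser_gr_span; split=> h pq r hpq; apply: h.
  exact/eqP.
by apply/negP => /eqP.
Qed.

Lemma total_direct : direct_sum (total (hser_gr G)).
Proof.
apply: (@direct_sum_proj _ _ _ (fun n => hres (fun pq => pq.1 + pq.2 == n))).
- by move=> i; apply/totalP.
- move=> i x y /totalP hx /totalP hy; apply/totalP => pq r h.
  by rewrite hvalB hx // hy // subr0.
- move=> x; apply: gsum_ind (direct_sum_span hser_gr_direct x).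
  + by exists [::]; rewrite ?big_nil.
  + move=> y z [s hs ->] [t ht ->]; exists (s ++ t); rewrite ?big_cat // => w.
    by rewrite mem_cat => /orP[/hs|/ht].
  + by move=> pq y _ hy; apply: (@gsum1 _ _ _ _ (pq.1 + pq.2)) => //; exact: (@gsum1 _ _ _ _ pq).
- by move=> i x y; exact: hresD.
- by move=> i x /totalP hx; apply: hres_id => pq r /hx.
- move=> i j x /totalP hx ij; apply: hres_eq0 => pq r /eqP E; apply: hx.
  by rewrite E; exact/eqP.
Qed.

(** Divisibility by a power of hbar is visible on coefficients, because hbar only
    shifts them along an antidiagonal. *)
Lemma hpowP n f : (forall pq r, (r < n)%N -> hval f pq r = 0) <->
  exists y : hser G, f = 'X^n *: y.
Proof.
split=> [h|[y ->] pq r hr]; last by rewrite hvalXn hr.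
have E : hval (hmk (fun pq r => hval f (pq.1 - n%:Z, pq.2 + n%:Z) (r + n)%N)) =
  (fun pq r => hval f (pq.1 - n%:Z, pq.2 + n%:Z) (r + n)%N).
  apply: hmkE => [pq r|].
    have := hserG f (pq.1 - n%:Z, pq.2 + n%:Z) (r + n)%N => /=.
    by congr (G _ _); rewrite PoszD; congr (_, _); lia.
  have [s hs] := hsupp f; exists [seq (x.1 + n%:Z, x.2 - n%:Z) | x <- s] => pq r hpq.
  apply: hs; apply: contra hpq => hpq; apply/mapP; exists (pq.1 - n%:Z, pq.2 + n%:Z) => //=.
  by rewrite subrK addrK; case: (pq).
exists (hmk (fun pq r => hval f (pq.1 - n%:Z, pq.2 + n%:Z) (r + n)%N)).
apply: hser_ext => pq r; rewrite hvalXn; case: ltnP => hr; first exact: h.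
by rewrite E /= addrK subrK subnK //; case: (pq).
Qed.

Lemma hpow_sep f : (forall n, exists y : hser G, f = 'X^n *: y) -> f = 0.
Proof.
move=> h; apply: hser_ext => pq r; have /hpowP := h r.+1; exact.
Qed.

(** No nonzero series is divisible by all powers of hbar, so that an identity
    which holds in all truncations holds exactly. *)
Lemma trunc_sep f :
  (forall N, (0 < N)%N -> qpi (hpow_submod (hser G) N) f = 0) -> f = 0.
Proof.
move=> h; apply: hpow_sep => n; have := h n.+1 isT.
rewrite -[RHS](qpi0 (hpow_submod (hser G) n.+1)) => /qpiP[y].
rewrite subr0 => ->; exists ('X^2 *: y).
by rewrite scalerA -exprD addn2.
Qed.

Lemma hunitE u : G (0, 0) u -> forall pq r,
  hval (hunit G u) pq r = if (pq == (0, 0)) && (r == 0%N) then u else 0.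
Proof.
move=> Gu pq r; rewrite /hunit hmonoE; first by case: eqP => // _; case: r.
by case=> [|r'] /=; [rewrite oppr0 addr0 | exact: submod0].
Qed.

Lemma hunit_gr u : G (0, 0) u -> hser_gr G 0 (hunit G u).
Proof.
by move=> Gu; apply/hser_grP => pq r /eqP h; rewrite hunitE // -[(0, 0)]/(0 : int * int) (negPf h).
Qed.

Lemma hredE (s : seq (int * int)) f : uniq s ->
  (forall pq r, pq \notin s -> hval f pq r = 0) ->
  hred G f = \sum_(pq <- s) hval f pq 0%N.
Proof. by move=> us hs; apply: fsum_setT => // pq /hs. Qed.

Lemma hred_lin c f g :
  hred G (c *: (f : hserk G) + g : hserk G) = c *: hred G f + hred G g.
Proof.
have [s hs] := hsupp f; have [t ht] := hsupp g.
have u := undup_uniq (s ++ t).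
have hs' pq r : pq \notin undup (s ++ t) -> hval f pq r = 0.
  by rewrite mem_undup mem_cat negb_or => /andP[/hs].
have ht' pq r : pq \notin undup (s ++ t) -> hval g pq r = 0.
  by rewrite mem_undup mem_cat negb_or => /andP[_ /ht].
rewrite (hredE u hs') (hredE u ht') (@hredE (undup (s ++ t))) //; last first.
  move=> pq r h; rewrite -[LHS]/(c *: hval f pq r + hval g pq r).
  by rewrite hs' // ht' // scaler0 addr0.
by rewrite scaler_sumr -big_split.
Qed.

Lemma hred_gr pq f : hser_gr G pq f -> hred G f = hval f pq 0%N.
Proof.
move=> /hser_grP hf; rewrite (@hredE [:: pq]) ?big_seq1 // => pq' r.
by rewrite inE => /eqP; exact: hf.
Qed.

Hypothesis dsG : direct_sum (fun pq => G pq).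

(** The constant coefficients lie in the different summands [G pq] of [B], so
    none of them can cancel in the sum. *)
Lemma hred_eq0 f : hred G f = 0 -> forall pq, hval f pq 0%N = 0.
Proof.
have [s us hs] := hsuppu f; rewrite (hredE us hs) => E pq.
have [spq|/hs//] := boolP (pq \in s).
apply: (direct_sum_free dsG us (f := fun pq => hval f pq 0%N)) => // -[p q] _.
by have := hserG f (p, q) 0; rewrite /= addr0 subr0.
Qed.

Lemma hmono0_mem pq b : G pq b ->
  forall r, G (pq.1 + r%:Z, pq.2 - r%:Z) (if r is 0 then b else 0).
Proof.
by case: pq => p q Gb [|r]; rewrite /= ?addr0 ?subr0 //; exact: submod0.
Qed.

Lemma hred_surj b : exists f, hred G f = b.
Proof.
apply: (@gsum_ind _ _ _ _ (fun b => exists f, hred G f = b)) (direct_sum_span dsG b).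
- exists 0; apply: (@fsbig1 _ _ _ _ _ (fun pq => hval (0 : hser G) pq 0%N)).
  by move=> pq.
- move=> _ _ [f <-] [g <-]; exists (f + g).
  by have := hred_lin 1 f g; rewrite !scale1r.
- move=> pq x _ Gx; exists (hmono G pq (fun r => if r is 0 then x else 0)).
  have E := hmonoE (hmono0_mem Gx).
  rewrite (@hred_gr pq) ?E ?eqxx // => pq' /eqP/negPf h.
  by rewrite E h.
Qed.

End Series.

(** * The operations of a formal deformation *)

Lemma trunc_inj (k : comNzRingType) (B : lmodType k) (G : int * int -> submod B)
    (f g : hser G) :
  (forall N, (0 < N)%N ->
     qpi (hpow_submod (hser G) N) f = qpi (hpow_submod (hser G) N) g) -> f = g.
Proof.
move=> h; apply/eqP; rewrite -subr_eq0; apply/eqP/trunc_sep => N /h /qpiP hN.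
by rewrite -(qpi0 (hpow_submod (hser G) N)); apply/qpiP; rewrite subr0.
Qed.

Lemma hpow_stable (k : comNzRingType) (M : lmodType {poly k}) N (m : seq M -> M) :
  multilinear m -> forall a x b, hpow_submod M N x -> hpow_submod M N (m (a ++ x :: b)).
Proof. by move=> ml a x b [y ->]; exists (m (a ++ y :: b)); rewrite multilinearZ. Qed.

Section Deformation.
Variables (k : comNzRingType) (B : lmodType k) (G : int * int -> submod B).
Variables (m : seq B -> B) (e : option B) (mt : seq (hser G) -> hser G).
Hypothesis HB : bigraded_ainf (@bigr_trivial k) (fun pq => G pq) m e.
Hypothesis HF : formal_deformation m e mt.

Let ml := fd_linear HF.

Definition in_row (p : int) (f : hser G) : Prop :=
  gsum (fun pq => pq.1 = p) (hser_gr G) f.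

Lemma in_rowP p f : in_row p f <-> forall pq r, pq.1 != p -> hval f pq r = 0.
Proof.
rewrite /in_row hser_gr_span; split=> h pq r hpq; apply: h; first exact/eqP.
by apply/negP => /eqP.
Qed.

Lemma mt_total d a : a <> [::] -> lies_in (total (hser_gr G)) d a ->
  total (hser_gr G) (\sum_(i <- d) i + (2 - (size a)%:Z)) (mt a).
Proof.
move=> a0 ha; apply: (multilinear_gsum (h := fun pq => pq.1 + pq.2) _ ml _ _ ha).
- by move=> i i' /=; rewrite addrACA.
- by apply/totalP.
- by move=> x y /totalP hx /totalP hy; apply/totalP => pq r h; rewrite hvalD hx // hy // addr0.
- move=> d' b sb hb E.
  have b0 : b <> [::] by move=> b0; apply: a0; apply: size0nil; rewrite -sb b0.
  have := fd_degree HF b0 hb; rewrite -E -sb.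
  by apply: gsum1 => /=; lia.
Qed.

Lemma mt_row d a : a <> [::] -> lies_in in_row d a -> in_row (\sum_(i <- d) i) (mt a).
Proof.
move=> a0 ha; apply: (multilinear_gsum (h := fst) _ ml _ _ ha) => //.
- exact/in_rowP.
- by move=> x y /in_rowP hx /in_rowP hy; apply/in_rowP => pq r h; rewrite hvalD hx // hy // addr0.
- move=> d' b sb hb E.
  have b0 : b <> [::] by move=> b0; apply: a0; apply: size0nil; rewrite -sb b0.
  by have := fd_degree HF b0 hb; rewrite -E; apply: gsum1; rewrite /= addr0.
Qed.

Lemma qop_trunc N a :
  qop (hpow_submod (hser G) N) mt (map (qpi (hpow_submod (hser G) N)) a) =
  qpi (hpow_submod (hser G) N) (mt a).
Proof. by apply: qop_qpi => // a' x b; exact: hpow_stable. Qed.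

(** Each truncation is an A-infinity algebra, hence the Stasheff sum vanishes
    modulo every power of hbar. *)
Lemma mt_relation d a : a <> [::] -> lies_in (total (hser_gr G)) d a ->
  stasheff mt d a = 0.
Proof.
move=> a0 ha; apply: trunc_inj => N N0.
have [_ _ _ _ + _] := fd_trunc HF N0; set S := hpow_submod _ N => hr.
rewrite qpi0 (@stasheff_morph _ _ (hser G) (trunc (hser G) N) (qpi S) mt (qop S mt)).
- apply: hr; first by case: (a) a0.
  apply: lies_in_map ha => n x; apply: gsum_map; first exact: qpiD.
  by move=> i y hy; exists y.
- exact: qpiD.
- by move=> b _; rewrite qop_trunc.
Qed.

Lemma unit_mem u : e = Some u -> G (0, 0) u.
Proof. exact: bigr_unit HB u. Qed.

Lemma mt_unital u : e = Some u -> unital mt (hunit G u).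
Proof.
move=> eu.
have h N : (0 < N)%N -> unital (qop (hpow_submod (hser G) N) mt)
    (qpi (hpow_submod (hser G) N) (hunit G u)).
  by move=> N0; have [_ _ _ _ _] := fd_trunc HF N0; rewrite eu => /(_ _ erefl)[].
split=> [x|x|a ua sa]; apply: trunc_inj => N N0; have [h1 h2 h3] := h N N0.
- by rewrite -(h1 (qpi _ x)) -qop_trunc.
- by rewrite -(h2 (qpi _ x)) -qop_trunc.
- by rewrite -qop_trunc h3 ?qpi0 ?size_map //; exact: map_f.
Qed.

(** A bihomogeneous polynomial in hbar is a monomial, as the powers of hbar have
    different bidegrees. *)
Lemma hser_scale_gr i pq (c : {poly k}) f :
  bigr_hbar i c -> hser_gr G pq f -> hser_gr G (i + pq) (c *: f).
Proof.
move=> hc /hser_grP hf; rewrite -[c]coefK poly_def scaler_suml; apply/hser_grP => pq' r h.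
rewrite hval_sum big1 // => j _; rewrite -mul_polyC -scalerA hvalC.
have [->|/hc ij] := eqVneq c`_j 0; first by rewrite scale0r.
rewrite hvalXn; case: ltnP => _; first by rewrite scaler0.
rewrite hf ?scaler0 // => E; apply: h; rewrite ij -E.
by case: (pq') => p q; congr (_, _) => /=; lia.
Qed.

Lemma hser_scale_total n (c : {poly k}) f :
  total (hser_gr G) n f -> total (hser_gr G) n (c *: f).
Proof.
move=> /totalP hf; rewrite -[c]coefK poly_def scaler_suml; apply/totalP => pq r h.
rewrite hval_sum big1 // => j _; rewrite -mul_polyC -scalerA hvalC.
rewrite hvalXn; case: ltnP => _; first by rewrite scaler0.
by rewrite hf ?scaler0 //=; move: h; congr (_ != _); lia.
Qed.

Lemma hser_bigraded_ainf :
  bigraded_ainf (@bigr_hbar k) (hser_gr G) mt (omap (hunit G) e).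
Proof.
split.
- split.
  + exact: total_direct.
  + by move=> n c x; exact: hser_scale_total.
  + exact: ml.
  + exact: mt_total.
  + exact: mt_relation.
  + move=> u; case eu: e => [v|] //= [<-]; split; last exact: mt_unital.
    apply: (@gsum1 _ _ _ _ 0) => //; exact/hunit_gr/unit_mem.
- exact: hser_gr_direct.
- by move=> i j c x; exact: hser_scale_gr.
- exact: fd_degree HF.
- by move=> u; case eu: e => [v|] //= [<-]; exact/hunit_gr/unit_mem.
Qed.

End Deformation.

(** * Setting hbar to 1: coefficients on the quotient by (hbar - 1) *)

Lemma seq_int_bounded (T : eqType) (h : T -> int) (s : seq T) :
  exists p0 p1 : int, forall x, x \in s -> p0 <= h x <= p1.
Proof.
elim: s => [|x s [p0 [p1 IH]]]; first by exists 0, 0.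
exists (Num.min p0 (h x)), (Num.max p1 (h x)) => y.
rewrite inE => /predU1P[->|/IH]; lia.
Qed.

Section Evaluation.
Variables (k : comNzRingType) (B : lmodType k) (G : int * int -> submod B).
Implicit Types (f g : hser G) (pq : int * int).

Lemma hsupp_bound f : exists (p0 p1 : int) (D : seq int), forall pq r,
  ~~ [&& p0 <= pq.1, pq.1 <= p1 & pq.1 + pq.2 \in D] -> hval f pq r = 0.
Proof.
have [s hs] := hsupp f; have [p0 [p1 hp]] := seq_int_bounded (fun pq : int * int => pq.1) s.
exists p0, p1, [seq pq.1 + pq.2 | pq <- s] => pq r h; apply: hs.
apply: contra h => hpq; have /andP[-> ->] := hp _ hpq.
by apply/mapP; exists pq.
Qed.

(** All coefficients of a series that lie in [B^pq] contribute, that of hbar^i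
    coming from bidegree [(p - i, q + i)].  In other words [ev] sets hbar to 1,
    with values in the graded completion of [B]. *)
Definition ev f pq : B :=
  \sum_(i \in [set: nat]%classic) hval f (pq.1 - i%:Z, pq.2 + i%:Z) i.

Lemma evE N f pq :
  (forall i, (N <= i)%N -> hval f (pq.1 - i%:Z, pq.2 + i%:Z) i = 0) ->
  ev f pq = \sum_(i < N) hval f (pq.1 - i%:Z, pq.2 + i%:Z) i.
Proof.
move=> h; rewrite /ev (@fsum_setT _ _ (iota 0 N)) ?iota_uniq //.
  by rewrite -(big_mkord xpredT (fun i => hval f (pq.1 - i%:Z, pq.2 + i%:Z) i)) /index_iota subn0.
by move=> i; rewrite mem_iota add0n /= -leqNgt; exact: h.
Qed.

Definition low (p0 : int) f := forall pq r, pq.1 < p0 -> hval f pq r = 0.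

Lemma hsupp_low f : exists p0 : int, low p0 f.
Proof.
have [p0 [p1 [D h]]] := hsupp_bound f; exists p0 => pq r hp; apply: h.
by rewrite leNgt hp.
Qed.

(** On each antidiagonal a series starts at some first degree, so that only
    finitely many powers of hbar contribute to a given value. *)
Lemma ev_low p0 f pq N : low p0 f -> pq.1 - p0 < N%:Z ->
  ev f pq = \sum_(i < N) hval f (pq.1 - i%:Z, pq.2 + i%:Z) i.
Proof. by move=> hf hN; apply: evE => i hi; apply: hf => /=; lia. Qed.

Lemma ev_low0 p0 f pq : low p0 f -> pq.1 < p0 -> ev f pq = 0.
Proof. by move=> hf hp; rewrite (@ev_low p0 _ _ 0) ?big_ord0 //; lia. Qed.

Lemma ev_lin c f g pq :
  ev (c *: (f : hserk G) + g : hserk G) pq = c *: ev f pq + ev g pq.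
Proof.
have [a ha] := hsupp_low f; have [b hb] := hsupp_low g.
pose d := Num.min a b; pose N := (`|pq.1 - d|%N).+1.
have lf : low d f by move=> x r h; apply: ha; rewrite /d in h; lia.
have lg : low d g by move=> x r h; apply: hb; rewrite /d in h; lia.
have hN : pq.1 - d < N%:Z by rewrite /N; lia.
rewrite (ev_low lf hN) (ev_low lg hN) (@ev_low d _ _ N) //; last first.
  move=> x r h; rewrite -[LHS]/(c *: hval f x r + hval g x r).
  by rewrite lf // lg // scaler0 addr0.
by rewrite scaler_sumr -big_split.
Qed.

Lemma ev_X f pq : ev ('X *: f) pq = ev f pq.
Proof.
have [a ha] := hsupp_low f; pose N := (`|pq.1 - a|%N).+1.
have hN : pq.1 - a < N%:Z by rewrite /N; lia.
have lX : low (a - 1) ('X *: f).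
  by move=> x [|r] h; rewrite hvalX //; apply: ha => /=; lia.
rewrite (ev_low ha hN) (@ev_low (a - 1) _ _ N.+1) //; last by lia.
rewrite big_ord_recl hvalX add0r; apply: eq_bigr => i _.
by rewrite hvalX /=; congr (hval f (_, _) _); rewrite /bump /=; lia.
Qed.

Lemma ev_G f pq : G pq (ev f pq).
Proof.
have [a ha] := hsupp_low f; pose N := (`|pq.1 - a|%N).+1.
rewrite (@ev_low a _ _ N) //; last by rewrite /N; lia.
elim/big_ind: _ => [|x y|i _]; [exact: submod0|exact: submodD|].
by have := hserG f (pq.1 - i%:Z, pq.2 + i%:Z) i; rewrite /= subrK addrK -surjective_pairing.
Qed.

Lemma ev_deg (D : seq int) f :
  (forall pq r, pq.1 + pq.2 \notin D -> hval f pq r = 0) ->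
  forall pq, pq.1 + pq.2 \notin D -> ev f pq = 0.
Proof.
move=> h pq hpq; apply: (@fsbig1 _ _ _ _ _ (fun i => hval f (pq.1 - i%:Z, pq.2 + i%:Z) i)).
by move=> i _; apply: h => /=; rewrite addrACA addNr addr0.
Qed.

(** A single row contributes exactly one coefficient to each value, which is why
    the rows embed in the quotient by (hbar - 1). *)
Lemma ev_row p f pq : in_row p f -> ev f pq =
  if p <= pq.1 then hval f (p, pq.2 + (pq.1 - p)) `|pq.1 - p|%N else 0.
Proof.
move=> /in_rowP hf; case: leP => hp; last first.
  by rewrite (@ev_low0 p) // => x r hx; apply: hf; rewrite lt_eqF.
rewrite /ev (@fsum_setT _ _ [:: `|pq.1 - p|%N]) ?big_seq1 //.
  by congr (hval f (_, _) _); lia.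
by move=> i; rewrite inE => hi; apply: hf => /=; move: hi; lia.
Qed.

(** The equation f = (hbar - 1) g is solved along each antidiagonal by the
    negative partial sums g_r = - (f_0 + ... + f_r).  They vanish for high first
    degree, where there is nothing to sum, and for low first degree, where the sum
    is complete and equal to the value of [ev]; so g has finite support. *)
Lemma ev_ker f : (forall pq, ev f pq = 0) <-> exists y : hser G, f = ('X - 1) *: y.
Proof.
split=> [h|[y ->] pq]; last first.
  rewrite scalerBl scale1r.
  have := ev_lin (-1) y ('X *: y) pq; rewrite ev_X [_ *: ev _ _]scaleN1r addNr => <-.
  by congr (ev _ pq); rewrite scaleN1r addrC.
(* The r-th negative partial sum along the antidiagonal; bidegree
   [(p + j, q - j)] with exponent [r - j] stays in the same [B^(p + r, q - r)]. *)
pose F pq r : B := - \sum_(j < r.+1) hval f (pq.1 + j%:Z, pq.2 - j%:Z) (r - j)%N.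
have FE : hval (hmk G F) = F.
  apply: hmkE => [[p q] r|].
    rewrite /F -scaleN1r; apply: submodZ; elim/big_ind: _ => [|x y|[j /= hj] _].
    - exact: submod0.
    - exact: submodD.
    - have := hserG f (p + j%:Z, q - j%:Z) (r - j)%N => /=.
      by congr (G (_, _) _); lia.
  have [p0 [p1 [D hf]]] := hsupp_bound f.
  exists [seq (p0 + i%:Z, n - (p0 + i%:Z)) | n <- D, i <- iota 0 (`|p1 - p0|%N).+1] => -[p q] r hpq.
  apply/eqP; rewrite oppr_eq0; apply/eqP.
  have [hD|hD] := boolP (p + q \in D); last first.
    rewrite big1 // => j _; apply: hf => /=; rewrite !negb_and; apply/orP; right.
    by apply/orP; right; rewrite (_ : p + j%:Z + (q - j%:Z) = p + q) //; lia.
  have [hp1|hp1] := ltP p1 p.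
    rewrite big1 // => j _; apply: hf => /=; lia.
  (* Rows between p0 and p1 with a total degree in D are on the list; the
     others are dealt with by the two ends of the support. *)
  have hp0 : p < p0.
    rewrite ltNge; apply: contra hpq => hp0; apply/allpairsP.
    exists (p + q, `|p - p0|%N); split=> //.
      by rewrite mem_iota /=; lia.
    by congr (_, _) => /=; lia.
  transitivity (ev f (p + r%:Z, q - r%:Z)); last exact: h.
  rewrite (@evE r.+1); last first.
    by move=> i hi /=; apply: hf => /=; lia.
  rewrite (reindex_inj rev_ord_inj); apply: eq_bigr => -[j hj] _ /=.
  by congr (hval f (_, _) _); lia.
exists (hmk G F); apply: hser_ext => -[p q] r.
rewrite scalerBl scale1r hvalB hvalX FE /F; case: r => [|r].
  by rewrite big_ord1 sub0r opprK /=; congr (hval f (_, _) _); lia.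
rewrite opprK [X in _ + X]big_ord_recl /= addrCA.
rewrite [X in _ + (_ + X)](eq_bigr (fun j : 'I_r.+1 =>
    hval f (p + 1 + j%:Z, q - 1 - j%:Z) (r - j)%N)); last first.
  by move=> i _; congr (hval f (_, _) _); rewrite /bump /=; lia.
by rewrite addNr addr0; congr (hval f (_, _) _); lia.
Qed.

Implicit Types (x y : Bbar G).

(** By [ev_ker] the values of [ev] depend only on the class modulo (hbar - 1),
    and determine it. *)
Definition bcoef x pq : B := ev (qrepr x) pq.

Lemma bcoef_class f pq : bcoef (Bbar_class f) pq = ev f pq.
Proof.
have /qpiP/ev_ker/(_ pq) : qpi (hbar1 G) (qrepr (Bbar_class f)) = qpi (hbar1 G) f.
  exact: qreprK.
rewrite -[_ - _]addrC -scaleN1r [ev _ _](ev_lin (-1) f _ pq) scaleN1r => /eqP.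
by rewrite addrC subr_eq0 => /eqP.
Qed.

Lemma bcoef_inj x y : (forall pq, bcoef x pq = bcoef y pq) -> x = y.
Proof.
move=> h; rewrite -[x]qreprK -[y]qreprK; apply/qpiP/ev_ker => pq.
rewrite -[_ - _]addrC -scaleN1r [LHS](ev_lin (-1)) scaleN1r.
by have := h pq; rewrite /bcoef => ->; rewrite addNr.
Qed.

Lemma bcoef_lin c x y pq : bcoef (c *: x + y) pq = c *: bcoef x pq + bcoef y pq.
Proof.
rewrite -[X in c *: X + _]qreprK -[X in _ + X]qreprK.
rewrite -[c *: qpi _ _]/(qscale _ _) qpiZ -qpiD [LHS]bcoef_class.
exact: ev_lin.
Qed.

Lemma bcoefD x y pq : bcoef (x + y) pq = bcoef x pq + bcoef y pq.
Proof. by rewrite -[x in LHS]scale1r bcoef_lin scale1r. Qed.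
Lemma bcoef0 pq : bcoef 0 pq = 0.
Proof. exact: (@addf0 _ _ (bcoef ^~ pq) (fun x y => bcoefD x y pq)). Qed.
Lemma bcoefN x pq : bcoef (- x) pq = - bcoef x pq.
Proof. exact: (@addfN _ _ (bcoef ^~ pq) (fun x y => bcoefD x y pq)). Qed.
Lemma bcoefB x y pq : bcoef (x - y) pq = bcoef x pq - bcoef y pq.
Proof. by rewrite bcoefD bcoefN. Qed.
Lemma bcoef_sum (I : Type) (s : seq I) (P : pred I) (F : I -> Bbar G) pq :
  bcoef (\sum_(i <- s | P i) F i) pq = \sum_(i <- s | P i) bcoef (F i) pq.
Proof. exact: (@addf_sum _ _ (bcoef ^~ pq) (fun x y => bcoefD x y pq)). Qed.

Lemma bcoefG x pq : G pq (bcoef x pq). Proof. exact: ev_G. Qed.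

Lemma bcoef_bound x : exists (p0 : int) (D : seq int), forall pq,
  (pq.1 < p0) || (pq.1 + pq.2 \notin D) -> bcoef x pq = 0.
Proof.
have [p0 [p1 [D h]]] := hsupp_bound (qrepr x).
exists p0, D => pq /orP[hp|hD].
  by apply: (@ev_low0 p0) => // pq' r hp'; apply: h; rewrite leNgt hp'.
by apply: (@ev_deg D) => // pq' r hp'; apply: h; rewrite (negPf hp') !andbF.
Qed.

(** A series in the single row [p0] with prescribed values of [ev], for families
    [h] that vanish below [p0]. *)
Definition rowser (p0 : int) (h : int * int -> B) : hser G :=
  hmk G (fun pq r => if pq.1 == p0 then h (pq.1 + r%:Z, pq.2 - r%:Z) else 0).

Lemma rowserE p0 (D : seq int) (h : int * int -> B) pq r :
  (forall pq, G pq (h pq)) -> (forall pq, pq.1 + pq.2 \notin D -> h pq = 0) ->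
  hval (rowser p0 h) pq r = if pq.1 == p0 then h (pq.1 + r%:Z, pq.2 - r%:Z) else 0.
Proof.
move=> hG hD; rewrite hmkE // => [pq' r'|]; first by case: ifP => _; [exact: hG|exact: submod0].
exists [seq (p0, n - p0) | n <- D] => -[p q] r' /=; case: eqP => // -> hpq.
apply: hD => /=; apply: contra hpq => hpq; apply/mapP.
by exists (p0 + q); [rewrite (_ : p0 + q = p0 + r'%:Z + (q - r'%:Z)) //; lia | congr (_, _); lia].
Qed.

Lemma rowser_bcoef p0 (D : seq int) (h : int * int -> B) :
  (forall pq, G pq (h pq)) -> (forall pq, pq.1 + pq.2 \notin D -> h pq = 0) ->
  (forall pq, pq.1 < p0 -> h pq = 0) ->
  forall pq, bcoef (Bbar_class (rowser p0 h)) pq = h pq.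
Proof.
move=> hG hD h0 [p q]; rewrite bcoef_class (@ev_row p0); last first.
  by apply/in_rowP => pq' r /negPf hp; rewrite (rowserE _ _ _ hG hD) hp.
rewrite (rowserE _ _ _ hG hD) /= eqxx; case: leP => hp; last by rewrite h0.
by congr (h (_, _)); lia.
Qed.

(** Such a family is realized within the single row [p0], as all its values lie at
    or above that row.  With [bcoef_bound] this determines the image of [bcoef]. *)
Lemma bfamily p0 (D : seq int) (h : int * int -> B) :
  (forall pq, G pq (h pq)) ->
  (forall pq, (pq.1 < p0) || (pq.1 + pq.2 \notin D) -> h pq = 0) ->
  exists x, forall pq, bcoef x pq = h pq.
Proof.
move=> hG hD; exists (Bbar_class (rowser p0 h)); apply: (@rowser_bcoef _ D) => // pq hp; apply: hD.
  by rewrite hp orbT.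
by rewrite hp.
Qed.

Lemma bres (P : pred (int * int)) x :
  exists y, forall pq, bcoef y pq = if P pq then bcoef x pq else 0.
Proof.
have [p0 [D h]] := bcoef_bound x; apply: (@bfamily p0 D) => pq.
  by case: ifP => _; [exact: bcoefG | exact: submod0].
by move=> /h->; rewrite if_same.
Qed.

Lemma Bbar_grP n x :
  Bbar_gr G n x <-> forall pq, pq.1 + pq.2 != n -> bcoef x pq = 0.
Proof.
split=> [[f /totalP hf ->] pq hpq|h].
  rewrite bcoef_class; apply: (@ev_deg [:: n]); rewrite ?inE // => pq' r.
  by rewrite inE; exact: hf.
have [p0 [D hx]] := bcoef_bound x; exists (rowser p0 (bcoef x)).
  apply/totalP => pq r hpq; rewrite (@rowserE _ [:: n]); last 2 first.
  - exact: bcoefG.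
  - by move=> pq'; rewrite inE; exact: h.
  by case: ifP => // _; apply: h => /=; move: hpq; congr (_ != _); lia.
apply: bcoef_inj => pq; rewrite [RHS](@rowser_bcoef _ [:: n]) //.
- exact: bcoefG.
- by move=> pq'; rewrite inE; exact: h.
- by move=> pq' hp; apply: hx; rewrite hp.
Qed.

(** A family that is bounded below either vanishes or has a first nonzero term, so
    that the default value in the definition of the valuation is harmless. *)
Lemma valuation_lt n (b : gcompl G n) p : p < valuation b -> b p = 0.
Proof.
rewrite /valuation; case: xgetP => [v _ [_ hv] /hv//|hn _].
have [p0 hb] := gcoef_bound b.
suff h j : b (p0 + j%:Z) = 0.
  have [/hb//|hp] := ltP p p0.
  by have := h `|p - p0|%N; congr (b _ = 0); lia.
elim/ltn_ind: j => j IH; apply: contrapT => hj.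
apply: (hn (p0 + j%:Z)); split=> // p' hp'.
have [/hb//|hp] := ltP p' p0.
by have := IH `|p' - p0|%N; rewrite (_ : p0 + _ = p'); last lia; apply; lia.
Qed.

Lemma bcoef_iota n (b : gcompl G n) pq :
  bcoef (iota' b) pq = if pq.1 + pq.2 == n then b pq.1 else 0.
Proof.
set v := valuation b.
have hE := @hmonoE k B G (v, n - v) (fun r => b (v + r%:Z)).
have {}hE : hval (hmono G (v, n - v) (fun r => b (v + r%:Z))) =
  (fun pq' r => if pq' == (v, n - v) then b (v + r%:Z) else 0).
  by apply: hE => r /=; rewrite -addrA -opprD; exact: gcoef_mem.
rewrite bcoef_class (@ev_row v); last first.
  by apply/in_rowP => pq' r; rewrite hE; have [->|//] := eqVneq pq' (v, n - v); rewrite eqxx.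
case: leP => [hp|/valuation_lt->]; last by rewrite if_same.
rewrite hE xpair_eqE eqxx /= (_ : (_ == n - v) = (pq.1 + pq.2 == n)); last by lia.
by case: eqP => // _; congr (b _); lia.
Qed.

End Evaluation.

Section Filtration.
Variables (k : fieldType) (B : lmodType k) (G : int * int -> submod B).
Implicit Types (x : Bbar G) (pq : int * int).

Lemma Bbar_filP p x :
  Bbar_fil G p x <-> forall pq, pq.1 < p -> bcoef x pq = 0.
Proof.
split=> [|h].
  apply: (@gsum_ind _ _ _ _ (fun x => forall pq, pq.1 < p -> bcoef x pq = 0)).
  - by move=> pq _; exact: bcoef0.
  - by move=> y z hy hz pq hp; rewrite bcoefD hy // hz // addr0.
  - by move=> n _ _ [b hb ->] pq hp; rewrite bcoef_iota hb // if_same.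
have [p0 [D hx]] := bcoef_bound x.
have bm n p' : G (p', n - p') (bcoef x (p', n - p')) by exact: bcoefG.
have bb n : exists p0, forall p', p' < p0 -> bcoef x (p', n - p') = 0.
  by exists p0 => p' hp; apply: hx; rewrite hp.
pose b n : gcompl G n := GCompl (bm n) (bb n).
have -> : x = \sum_(n <- undup D) iota' (b n).
  apply: bcoef_inj => pq; rewrite bcoef_sum.
  rewrite (eq_bigr (fun n => if pq.1 + pq.2 == n then bcoef x pq else 0)); last first.
    move=> n _; rewrite bcoef_iota; case: eqP => // E; congr (bcoef x _).
    by case: pq E => p' q /= <-; congr (_, _); lia.
  have [hD|hD] := boolP (pq.1 + pq.2 \in undup D).
    rewrite (bigD1_seq _ hD (undup_uniq D)) /= eqxx big1 ?addr0 // => n hn.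
    by rewrite eq_sym (negPf hn).
  rewrite hx; first by rewrite big1 // => n _; rewrite if_same.
  by rewrite mem_undup in hD; rewrite hD orbT.
apply: gsum_sum => n _; split=> //; exists (b n) => // p' hp' /=; exact: h.
Qed.

(** With [Bbar_fil_class]: the filtration step [F p] is the image of the row [p],
    which is the heart of the comparison with the Rees algebra. *)
Lemma Bbar_fil_row p x : Bbar_fil G p x ->
  exists2 f : hser G, in_row p f & x = Bbar_class f.
Proof.
move=> /Bbar_filP h; have [p0 [D hx]] := bcoef_bound x.
have hD pq : pq.1 + pq.2 \notin D -> bcoef x pq = 0 by move=> hpq; rewrite hx // hpq orbT.
exists (rowser G p (bcoef x)).
  apply/in_rowP => pq r /negPf hp; rewrite (@rowserE _ _ _ _ D) ?hp // => ?; exact: bcoefG.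
apply: bcoef_inj => pq; rewrite (@rowser_bcoef _ _ _ _ D) // => ?; exact: bcoefG.
Qed.

Lemma Bbar_fil_class p (f : hser G) : in_row p f -> Bbar_fil G p (Bbar_class f).
Proof.
by move=> hf; apply/Bbar_filP => pq hp; rewrite bcoef_class (ev_row _ hf) leNgt hp.
Qed.

End Filtration.

(** * The filtered algebra at hbar = 1 *)

Section BbarRestriction.
Variables (k : comNzRingType) (B : lmodType k) (G : int * int -> submod B).
Implicit Types (x y : Bbar G) (P : pred (int * int)).

(** Such an element exists by [bres] and is unique by [bcoef_inj], so the choice is
    no choice at all and [bcut P] is additive. *)
Definition bcut P x : Bbar G :=
  xget 0 [set y | forall pq, bcoef y pq = if P pq then bcoef x pq else 0]%classic.

Lemma bcutE P x pq : bcoef (bcut P x) pq = if P pq then bcoef x pq else 0.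
Proof.
have [y hy] := bres P x; rewrite /bcut; case: xgetP => [z _ ->//|/(_ y)].
by case.
Qed.

Definition on_total n : pred (int * int) := fun pq => pq.1 + pq.2 == n.

Lemma bcut_gr n x : Bbar_gr G n (bcut (on_total n) x).
Proof. by apply/Bbar_grP => pq /negPf h; rewrite bcutE /on_total h. Qed.

Lemma bcut_id n x : Bbar_gr G n x -> bcut (on_total n) x = x.
Proof.
move=> /Bbar_grP h; apply: bcoef_inj => pq; rewrite bcutE /on_total.
by case: ifPn => // /h.
Qed.

Lemma bcutD P x y : bcut P (x + y) = bcut P x + bcut P y.
Proof.
apply: bcoef_inj => pq; rewrite bcoefD !bcutE bcoefD.
by case: ifP; rewrite ?addr0.
Qed.

Lemma bcut_other n n' x : Bbar_gr G n' x -> n != n' -> bcut (on_total n) x = 0.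
Proof.
move=> /Bbar_grP h nn; apply: bcoef_inj => pq; rewrite bcutE bcoef0 /on_total.
by case: eqP => // E; apply: h; rewrite E.
Qed.

Lemma bcut_sum x : exists2 D : seq int, uniq D &
  x = \sum_(n <- D) bcut (on_total n) x.
Proof.
have [p0 [D hx]] := bcoef_bound x; exists (undup D); first exact: undup_uniq.
apply: bcoef_inj => pq; rewrite bcoef_sum.
under eq_bigr do rewrite bcutE /on_total.
have [hD|hD] := boolP (pq.1 + pq.2 \in undup D).
  rewrite (bigD1_seq _ hD (undup_uniq D)) /= eqxx big1 ?addr0 // => n hn.
  by rewrite eq_sym (negPf hn).
rewrite hx; first by rewrite big1 // => n _; rewrite if_same.
by rewrite mem_undup in hD; rewrite hD orbT.
Qed.

Lemma Bbar_decomp (P : int -> Prop) (Q : Bbar G -> Prop) x :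
  (forall n, P n -> Q (bcut (on_total n) x)) ->
  (forall n, ~ P n -> bcut (on_total n) x = 0) ->
  gsum P (fun n y => Q y /\ Bbar_gr G n y) x.
Proof.
move=> hQ h0; have [D _ E] := bcut_sum x.
rewrite E (bigID (fun n => `[< P n >])) /= [X in _ + X]big1 ?addr0; last first.
  by move=> n /asboolP; exact: h0.
rewrite -big_filter; apply: gsum_sum => n; rewrite mem_filter => /andP[/asboolP Pn _].
by split=> //; split; [exact: hQ | exact: bcut_gr].
Qed.

Lemma Bbar_direct : direct_sum (fun n => Bbar_gr G n).
Proof.
apply: (@direct_sum_proj _ _ _ (fun n => bcut (on_total n))).
- by move=> i; exact: submod0.
- by move=> i x y; exact: submodB.
- move=> x; have [D _ ->] := bcut_sum x.
  by apply: gsum_sum => n _; split=> //; exact: bcut_gr.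
- by move=> i x y; exact: bcutD.
- by move=> i x; exact: bcut_id.
- by move=> i j x gx /eqP; exact: bcut_other.
Qed.

End BbarRestriction.

Section BbarAlgebra.
Variables (k : fieldType) (B : lmodType k) (G : int * int -> submod B).
Variables (m : seq B -> B) (e : option B) (mt : seq (hser G) -> hser G).
Hypothesis HB : bigraded_ainf (@bigr_trivial k) (fun pq => G pq) m e.
Hypothesis HF : formal_deformation m e mt.

Let ml := fd_linear HF.

Lemma mt_k_linear : @multilinear k (hserk G) (hserk G) mt.
Proof.
move=> a b c x y; have := ml a b c%:P x y.
by rewrite !polymodC.
Qed.

(** The operations are linear over k[hbar], so they absorb multiples of hbar - 1. *)
Lemma hbar1_stable (a : seq (hserk G)) x b :
  hbar1 G x -> hbar1 G (mt (a ++ x :: b)).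
Proof.
case=> y ->; exists (mt (a ++ y :: b)).
exact: (@multilinearZ _ _ _ mt a b ('X - 1) y ml).
Qed.

Lemma Bbar_op_class (a : seq (hser G)) :
  Bbar_op mt (map (@Bbar_class _ _ G) a) = Bbar_class (mt a).
Proof. exact: qop_qpi mt_k_linear hbar1_stable. Qed.

Lemma Bbar_op_linear : multilinear (Bbar_op mt).
Proof. exact: qop_multilinear mt_k_linear hbar1_stable. Qed.

Lemma Bbar_ainf : ainf_algebra (fun n => Bbar_gr G n) (Bbar_op mt) (Bbar_unit G e).
Proof.
apply: (@ainf_image _ _ (hser G) (Bbar G) (@Bbar_class _ _ G)
  _ _ mt _ (omap (hunit G) e) _ _ _ _ _ _ _ _ _ (bigr_ainf (hser_bigraded_ainf HB HF))).
- by move=> x y; exact: qpiD.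
- by move=> y; exists (qrepr y); exact: qreprK.
- by move=> n y; split.
- by move=> a _; rewrite Bbar_op_class.
- by rewrite /Bbar_unit; case: e.
- exact: Bbar_direct.
- by move=> n c x; exact: submodZ.
- exact: Bbar_op_linear.
Qed.

(** The operations add filtration steps because rows add.  For completeness, the
    coefficients of first degree [p] of a Cauchy family are constant from the index
    [p + 1] on, and these stable values are the coefficients of the limit. *)
Lemma Bbar_filtered : filtered_ainf (fun n => Bbar_gr G n) (Bbar_fil G)
  (Bbar_op mt) (Bbar_unit G e).
Proof.
split.
- exact: Bbar_ainf.
- move=> p x /Bbar_filP hx; apply: Bbar_decomp => n // _; apply/Bbar_filP => pq hp.
  by rewrite bcutE hx // if_same.
- move=> d a a0 ha; have [b hb E] : exists2 b, lies_in (@in_row _ _ G) d b &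
      a = map (@Bbar_class _ _ G) b.
    by apply: lies_in_lift ha => p x; exact: Bbar_fil_row.
  rewrite E Bbar_op_class; apply/Bbar_fil_class/(mt_row HF) => //.
  by move=> b0; rewrite E b0 in a0.
- move=> u; rewrite /Bbar_unit; case eu: e => [v|] //= [<-].
  apply: Bbar_fil_class; apply: (@gsum1 _ _ _ _ 0) => //.
  exact/hunit_gr/(unit_mem HB eu).
- move=> x; have [p0 [D hx]] := bcoef_bound x; exists p0; apply/Bbar_filP => pq hp.
  by apply: hx; rewrite hp.
- move=> n x _ hx; apply: bcoef_inj => pq; rewrite bcoef0.
  by have /Bbar_filP := hx (pq.1 + 1); apply; rewrite ltrDl.
- move=> n x hn hx; have [p0 [D h0]] := bcoef_bound (x 0).
  have hd (q q' : int) (pq : int * int) : q <= q' -> pq.1 < q -> bcoef (x q) pq = bcoef (x q') pq.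
    move=> hq hp; have /Bbar_filP/(_ pq hp) := hx _ _ hq.
    by rewrite bcoefB => /eqP; rewrite subr_eq0 => /eqP.
  have [y hy] : exists y : Bbar G, forall pq, bcoef y pq = bcoef (x (pq.1 + 1)) pq.
    (* Below -1 the family is compared with the element of index 0, whose
       coefficients vanish below p0. *)
    apply: (@bfamily _ _ _ (Num.min p0 (-1)) [:: n]) => pq; first exact: bcoefG.
    case/orP => [hp|]; last by rewrite inE; have /Bbar_grP := hn (pq.1 + 1); apply.
    by rewrite (hd _ 0); [rewrite h0 //; apply/orP; left; lia | lia | lia].
  exists y.
    by apply/Bbar_grP => pq hpq; rewrite hy; have /Bbar_grP := hn (pq.1 + 1); apply.
  by move=> q; apply/Bbar_filP => pq hp; rewrite bcoefB hy (hd _ q) ?subrr //; lia.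
Qed.

End BbarAlgebra.

(** * The Rees algebra and the associated graded *)

Lemma multilinear_mem0 (R : pzRingType) (A B : lmodType R) (m : seq A -> B) a :
  multilinear m -> 0 \in a -> m a = 0.
Proof.
move=> ml /(nthP 0)[i hi E]; rewrite -(cat_take_drop i a) (drop_nth 0) // E.
exact: multilinear0.
Qed.

Section Rees.
Variables (k : comNzRingType) (A : lmodType k) (F : filtration A).
Implicit Types (u v : rees F).

Lemma rees_ext u v : (forall p, rval u p = rval v p) -> u = v.
Proof. by move=> h; apply/val_inj/funext. Qed.

Lemma rvalF u p : F p (rval u p).
Proof. by case: u => u /= /asboolP[]. Qed.

Lemma rsupp u : exists s : seq int, forall p, p \notin s -> rval u p = 0.
Proof. by case: u => u /= /asboolP[_ /finite_suppP]. Qed.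

Lemma rvalX u p : rval ('X *: u) p = rval u (p + 1).
Proof. by rewrite polymodX. Qed.

Definition rmk (f : int -> A) : rees F := insubd (0 : reesk F) f.

Lemma rmkE f : (forall p, F p (f p)) ->
  (exists s : seq int, forall p, p \notin s -> f p = 0) -> rval (rmk f) = f.
Proof.
move=> Ff hs; rewrite [LHS]val_insubd ifT //; apply/asboolP; split=> //.
exact/finite_suppP.
Qed.

End Rees.

Section ReesIso.
Variables (k : fieldType) (B : lmodType k) (G : int * int -> submod B).
Notation F := (Bbar_fil G).
Notation gr := (Bbar_gr G).
Implicit Types (u v : rees F) (f g : hser G) (pq : int * int).

Definition row_of p f : hser G := hres (fun pq => pq.1 == p) f.

Lemma row_of_in p f : in_row p (row_of p f).
Proof. by apply/in_rowP => pq r /negPf h; rewrite hresE h. Qed.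

(** Only finitely many terms of an element of the Rees module are nonzero, each
    with finitely many total degrees. *)
Lemma rees_deg u : exists D : seq int, forall p pq,
  pq.1 + pq.2 \notin D -> bcoef (rval u p) pq = 0.
Proof.
have [s hs] := rsupp u.
suff [D hD] : exists D : seq int, forall p pq,
    p \in s -> pq.1 + pq.2 \notin D -> bcoef (rval u p) pq = 0.
  exists D => p pq h; have [sp|/hs->] := boolP (p \in s); last exact: bcoef0.
  exact: hD.
elim: s {hs} => [|p s [D IH]]; first by exists [::].
have [p0 [D' hD']] := bcoef_bound (rval u p).
exists (D' ++ D) => p' pq; rewrite inE mem_cat negb_or => /predU1P[->|hp] /andP[h1 h2].
  by rewrite hD' // h1 orbT.
exact: IH.
Qed.

(** The inverse of [hser_to_rees]: the term of hbar^(-p) is read as a series in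
    the row [p]. *)
Definition rees_to_hser u : hser G :=
  hmk G (fun pq r => bcoef (rval u pq.1) (pq.1 + r%:Z, pq.2 - r%:Z)).

Lemma rees_to_hserE u pq r :
  hval (rees_to_hser u) pq r = bcoef (rval u pq.1) (pq.1 + r%:Z, pq.2 - r%:Z).
Proof.
rewrite hmkE // => [pq' r'|]; first exact: bcoefG.
have [s hs] := rsupp u; have [D hD] := rees_deg u.
exists [seq (p, n - p) | p <- s, n <- D] => -[p q] r' hpq /=.
have [sp|/hs->] := boolP (p \in s); last exact: bcoef0.
apply: hD => /=; apply: contra hpq => hn; apply/allpairsP; exists (p, p + q).
split=> //=; last by congr (_, _); lia.
by rewrite (_ : p + q = p + r'%:Z + (q - r'%:Z)) //; lia.
Qed.

Lemma bcoef_rees u p pq : bcoef (rval u p) pq =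
  if p <= pq.1 then hval (rees_to_hser u) (p, pq.2 + (pq.1 - p)) `|pq.1 - p|%N else 0.
Proof.
case: leP => hp; last by have /Bbar_filP := rvalF u p; apply.
by rewrite rees_to_hserE /=; congr (bcoef _ _); case: pq hp => a b /= hp; congr (_, _); lia.
Qed.

(** A series is cut into its rows, and hbar is set to 1 in each of them; the
    power of hbar that is lost is remembered by the index of the row. *)
Definition hser_to_rees f : rees F := rmk F (fun p => Bbar_class (row_of p f)).

Lemma hser_to_reesE f p : rval (hser_to_rees f) p = Bbar_class (row_of p f).
Proof.
rewrite rmkE // => [p'|]; first exact/Bbar_fil_class/row_of_in.
have [s hs] := hsupp f; exists [seq pq.1 | pq <- s] => p' hp.
rewrite /row_of hres_eq0; first exact: qpi0.
move=> pq r /eqP E; apply: hs; apply: contra hp => hpq; apply/mapP.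
by exists pq.
Qed.

Lemma hser_to_reesK : cancel hser_to_rees rees_to_hser.
Proof.
move=> f; apply: hser_ext => -[p q] r.
rewrite rees_to_hserE hser_to_reesE bcoef_class (ev_row _ (row_of_in p f)) /=.
rewrite lerDl le0z_nat hresE eqxx.
by congr (hval f (_, _) _); lia.
Qed.

Lemma rees_to_hserK : cancel rees_to_hser hser_to_rees.
Proof.
move=> u; apply: rees_ext => p; apply: bcoef_inj => pq.
rewrite hser_to_reesE bcoef_class (ev_row _ (row_of_in _ _)) hresE eqxx.
by rewrite -bcoef_rees.
Qed.

Lemma hser_to_rees_bij : bijective hser_to_rees.
Proof. exact: Bijective hser_to_reesK rees_to_hserK. Qed.

Lemma hser_to_rees_linear (c : {poly k}) f g :
  hser_to_rees (c *: f + g) = c *: hser_to_rees f + hser_to_rees g.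
Proof.
apply: polymod_linear => [{}c x y|x]; apply: rees_ext => p.
  rewrite -[RHS]/(c *: rval (hser_to_rees x) p + rval (hser_to_rees y) p).
  rewrite !hser_to_reesE; apply: bcoef_inj => pq.
  rewrite bcoef_lin !bcoef_class -ev_lin; congr (ev _ pq).
  apply: hser_ext => pq' r.
  rewrite -[RHS]/(c *: hval (row_of p x) pq' r + hval (row_of p y) pq' r) !hresE.
  by case: ifP => // _; rewrite scaler0 addr0.
rewrite rvalX !hser_to_reesE; apply: bcoef_inj => pq.
rewrite !bcoef_class -[RHS]ev_X; congr (ev _ pq).
apply: hser_ext => pq' r; rewrite hvalX hresE hvalX.
case: r => [|r]; first by rewrite if_same.
rewrite hresE /= (_ : (pq'.1 + 1 == p + 1) = (pq'.1 == p)) //.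
by rewrite (inj_eq (addIr _)).
Qed.

Lemma rees_to_hser_linear c u v :
  rees_to_hser (c *: (u : reesk F) + v : reesk F) =
  c *: (rees_to_hser u : hserk G) + rees_to_hser v :> hserk G.
Proof.
apply: hser_ext => pq r.
rewrite -[RHS]/(c *: hval (rees_to_hser u) pq r + hval (rees_to_hser v) pq r).
rewrite !rees_to_hserE -bcoef_lin; congr (bcoef _ _).
Qed.

Lemma rees_grP pq u : rees_gr F gr pq u <-> hser_gr G pq (rees_to_hser u).
Proof.
split=> [[/Bbar_grP h1 h2]|/hser_grP h].
  apply/hser_grP => -[p q] r hpq; rewrite rees_to_hserE /=.
  have [E|/eqP/h2->] := eqVneq p pq.1; last exact: bcoef0.
  rewrite E; apply: h1 => /=; apply: contraPneq hpq => hs; apply.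
  by rewrite E; case: (pq) hs => a b /= hs; congr (_, _); lia.
split=> [|p hp].
  apply/Bbar_grP => ab hab; rewrite bcoef_rees; case: leP => // hp.
  by rewrite h // => E; move/eqP: hab; apply; rewrite -E /=; lia.
apply: bcoef_inj => ab; rewrite bcoef0 bcoef_rees; case: leP => // _.
by rewrite h // => E; apply: hp; rewrite -E.
Qed.

Lemma hser_to_rees_gr pq f : rees_gr F gr pq (hser_to_rees f) <-> hser_gr G pq f.
Proof. by rewrite rees_grP hser_to_reesK. Qed.

Variables (m : seq B -> B) (e : option B) (mt : seq (hser G) -> hser G).
Hypothesis HB : bigraded_ainf (@bigr_trivial k) (fun pq => G pq) m e.
Hypothesis HF : formal_deformation m e mt.

Let ml := fd_linear HF.

Lemma common_rows (a : seq (hser G)) : exists2 s : seq int, uniq s &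
  forall f, f \in a -> forall pq r, pq.1 \notin s -> hval f pq r = 0.
Proof.
suff [s hs] : exists s : seq int, forall f, f \in a ->
    forall pq r, pq.1 \notin s -> hval f pq r = 0.
  exists (undup s) => [|f fa pq r]; first exact: undup_uniq.
  by rewrite mem_undup; exact: hs.
elim: a => [|f a [s IH]]; first by exists [::].
have [t ht] := hsupp f; exists ([seq pq.1 | pq <- t] ++ s) => g.
rewrite inE => /predU1P[->|ga] pq r; rewrite mem_cat negb_or => /andP[h1 h2].
  by apply: ht; apply: contra h1 => h; apply/mapP; exists pq.
exact: IH.
Qed.

Lemma row_sum (s : seq int) f : uniq s ->
  (forall pq r, pq.1 \notin s -> hval f pq r = 0) -> f = \sum_(j <- s) row_of j f.
Proof.
move=> us hs; apply: hser_ext => pq r; rewrite hval_sum.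
under eq_bigr do rewrite hresE.
have [hp|hp] := boolP (pq.1 \in s).
  rewrite (bigD1_seq _ hp us) /= eqxx big1 ?addr0 // => j hj.
  by rewrite eq_sym (negPf hj).
by rewrite hs // big1 // => j _; rewrite if_same.
Qed.

Lemma zip_rows (a : seq (hser G)) w :
  [seq rval up.1 up.2 | up <- zip (map hser_to_rees a) w] =
  map (@Bbar_class _ _ G) [seq row_of up.2 up.1 | up <- zip a w].
Proof.
by elim: a w => [|f a IH] [|p w] //=; rewrite IH hser_to_reesE.
Qed.

Lemma lies_in_rows (a : seq (hser G)) w : size w = size a ->
  lies_in (@in_row _ _ G) w [seq row_of up.2 up.1 | up <- zip a w].
Proof.
elim: a w => [|f a IH] [|p w] //= [sw].
by apply/lies_in_cons; split; [exact: row_of_in | exact: IH].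
Qed.

Lemma row_of_row p p' f : in_row p f -> row_of p' f = if p == p' then f else 0.
Proof.
move=> /in_rowP hf; case: eqVneq => [<-|hp]; first by apply: hres_id => pq r; exact: hf.
by apply: hres_eq0 => pq r /eqP E; apply: hf; rewrite E eq_sym.
Qed.

(** Expanding every argument into its rows turns the deformed operation into a sum
    over words of rows.  The words of sum [p] contribute to the row [p], which is
    the defining formula of the Rees operation.  As this formula gives the terms
    of an element of the Rees module, the default value in the definition of
    [rees_op] does not occur. *)
Lemma hser_to_rees_op (a : seq (hser G)) : a <> [::] ->
  hser_to_rees (mt a) = rees_op F (Bbar_op mt) (map hser_to_rees a).
Proof.
move=> a0; rewrite -[LHS](valKd (0 : reesk F)) /rees_op; congr (insubd _ _).
apply/funext => p; rewrite -[LHS]/(rval _ p) hser_to_reesE size_map.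
have [s us hs] := common_rows a.
have cD (f g : hser G) : Bbar_class (f + g) = Bbar_class f + Bbar_class g by exact: qpiD.
rewrite (multilinear_expand (s := s) (pr := row_of) ml); last first.
  by move=> f fa; apply: row_sum => // pq r; exact: hs.
rewrite (@addf_sum _ _ (row_of p) (@hresD _ _ _ _)) (addf_sum cD).
rewrite (_ : [set _ | _]%classic = [set` (fun w : seq int => (size w == size a) && (\sum_(i <- w) i == p))]%classic); last first.
  by apply/seteqP; split=> w /=; rewrite unfold_in; [case=> -> ->; rewrite !eqxx | case/andP=> /eqP-> /eqP->].
rewrite -(@bigfs _ _ _ _ (words s (size a))); last 2 first.
- exact: words_uniq.
- move=> w /andP[/eqP sw _] nw; rewrite zip_rows multilinear_mem0 //; first exact: Bbar_op_linear HF.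
  (* A letter outside s selects a zero row of some argument. *)
  have /allPn[j jw js] : ~~ all (mem s) w.
    by apply: contra nw => /allP h; apply/wordsP.
  have [i iw E] := nthP 0 jw.
  apply/mapP; exists (row_of j (nth 0 a i)).
    apply/mapP; exists (nth 0 a i, j) => //; rewrite -E -nth_zip //.
    by apply: mem_nth; rewrite size_zip sw minnn -sw.
  rewrite /row_of hres_eq0; first by apply/esym/qpi0.
  move=> pq r /eqP pj; apply: (hs (nth 0 a i)); last by rewrite pj.
  by apply: mem_nth; rewrite -sw.
rewrite [RHS]big_mkcond /= !big_seq; apply: eq_bigr => w /wordsP[sw _].
rewrite sw eqxx /= (@row_of_row (\sum_(i <- w) i)); last first.
  apply: (mt_row HF); last exact: lies_in_rows.
  by move/(congr1 size)/eqP; rewrite size_map size_zip sw minnn size_eq0 => /eqP.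
case: eqP => _; last exact: qpi0.
by rewrite zip_rows (Bbar_op_class HF).
Qed.

Lemma hser_to_rees_unit : omap hser_to_rees (omap (hunit G) e) =
  rees_unit F (Bbar_unit G e).
Proof.
rewrite /rees_unit /Bbar_unit; case eu: e => [u|] //=; congr Some.
have u0 : in_row 0 (hunit G u).
  by apply: (@gsum1 _ _ _ _ 0) => //; exact/hunit_gr/(unit_mem HB eu).
apply: rees_ext => p; rewrite hser_to_reesE rmonoE; last exact: Bbar_fil_class.
rewrite (row_of_row _ u0) eq_sym; case: eqP => // _; exact: qpi0.
Qed.

Lemma rees_bigraded : bigraded_ainf (@bigr_hbar k) (rees_gr F gr)
  (rees_op F (Bbar_op mt)) (rees_unit F (Bbar_unit G e)).
Proof.
apply: (bigraded_transport hser_to_rees_linear hser_to_rees_bij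
  hser_to_rees_op hser_to_rees_unit hser_to_rees_gr).
exact: hser_bigraded_ainf HB HF.
Qed.

Lemma hser_to_rees_iso : strict_iso (hser_gr G) mt (omap (hunit G) e)
  (rees_gr F gr) (rees_op F (Bbar_op mt)) (rees_unit F (Bbar_unit G e)) hser_to_rees.
Proof.
split; [split|exact: hser_to_rees_op|exact: hser_to_rees_unit].
- exact: hser_to_rees_linear.
- exact: hser_to_rees_bij.
- by move=> i x /hser_to_rees_gr.
Qed.

Lemma rees_to_hser_op (us : seq (rees F)) : us <> [::] ->
  rees_to_hser (rees_op F (Bbar_op mt) us) = mt (map rees_to_hser us).
Proof.
move=> u0; rewrite -[X in rees_op _ _ X](mapK rees_to_hserK) -hser_to_rees_op.
  exact: hser_to_reesK.
by case: (us) u0.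
Qed.

Let dsG := bigr_direct HB.

(** Reduction modulo hbar, seen from the Rees module, which maps onto the
    associated graded. *)
Definition symbol (x : assoc_gr F) : B := hred G (rees_to_hser (qrepr x)).

(** An element of the Rees module is in the kernel of the map to the associated
    graded when every term lies one step deeper than required, that is when all
    constant coefficients of the corresponding series vanish. *)
Lemma gr_kerP u : gr_ker F u <-> hred G (rees_to_hser u) = 0.
Proof.
split=> [h|/(hred_eq0 dsG) h p].
  apply: (@fsbig1 _ _ _ _ _ (fun pq => hval (rees_to_hser u) pq 0%N)) => pq _.
  rewrite rees_to_hserE; have /Bbar_filP := h pq.1; apply; rewrite /=; lia.
apply/Bbar_filP => pq hp; rewrite bcoef_rees; case: leP => // hp'.
by rewrite (_ : `|_|%N = 0%N) //; lia.
Qed.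

Lemma hred_rees_linear c u v : hred G (rees_to_hser (c *: (u : reesk F) + v : reesk F)) =
  c *: hred G (rees_to_hser u) + hred G (rees_to_hser v).
Proof. by rewrite rees_to_hser_linear hred_lin. Qed.

Lemma symbolE u : symbol (qpi (gr_ker F) u) = hred G (rees_to_hser u).
Proof.
have /qpiP/gr_kerP : qpi (gr_ker F) (qrepr (qpi (gr_ker F) u)) = qpi (gr_ker F) u.
  exact: qreprK.
rewrite -[_ - _]addrC -scaleN1r [X in X = 0]hred_rees_linear scaleN1r => /eqP.
by rewrite addrC subr_eq0 => /eqP.
Qed.

Lemma symbol_linear c x y : symbol (c *: x + y) = c *: symbol x + symbol y.
Proof.
rewrite -[X in c *: X + _]qreprK -[X in _ + X]qreprK.
rewrite -[c *: qpi _ _]/(qscale _ _) qpiZ -qpiD [LHS]symbolE.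
exact: hred_rees_linear.
Qed.

Lemma symbol_bij : bijective symbol.
Proof.
apply: inj_surj_bij => [x y E|b].
  rewrite -[x]qreprK -[y]qreprK; apply/qpiP/gr_kerP.
  rewrite -[_ - _]addrC -scaleN1r [LHS]hred_rees_linear scaleN1r.
  by rewrite -[hred _ (_ (qrepr x))]/(symbol x) E addNr.
have [f <-] := hred_surj dsG b; exists (qpi (gr_ker F) (hser_to_rees f)).
by rewrite symbolE hser_to_reesK.
Qed.

Lemma rees_to_hser_rmono p x : Bbar_fil G p x -> forall pq r,
  hval (rees_to_hser (rmono F p x)) pq r =
  if pq.1 == p then bcoef x (pq.1 + r%:Z, pq.2 - r%:Z) else 0.
Proof.
move=> Fx pq r; rewrite rees_to_hserE rmonoE //; case: eqP => // _; exact: bcoef0.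
Qed.

Lemma symbol_class p n x : Bbar_fil G p x -> Bbar_gr G n x ->
  symbol (gr_class F p x) = bcoef x (p, n - p).
Proof.
move=> Fx /Bbar_grP gx; rewrite /gr_class symbolE (@hred_gr _ _ _ (p, n - p)).
  by rewrite rees_to_hserE rmonoE //= eqxx addr0 subr0.
apply/hser_grP => pq r hpq; rewrite rees_to_hser_rmono //; case: eqP => // E.
apply: gx => /=; apply: contraPneq hpq => <-; apply.
by case: (pq) E => a b /= ->; congr (_, _); lia.
Qed.

Lemma iota_fil n p (b : gcompl G n) : gcompl_fil p b -> Bbar_fil G p (iota' b).
Proof.
by move=> hb; apply/Bbar_filP => pq hp; rewrite bcoef_iota hb // if_same.
Qed.

Lemma iota_gr n (b : gcompl G n) : Bbar_gr G n (iota' b).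
Proof. by apply/Bbar_grP => pq /negPf h; rewrite bcoef_iota h. Qed.

Lemma symbol_iota n p (b : gcompl G n) : gcompl_fil p b ->
  symbol (gr_class F p (iota' b)) = b p.
Proof.
move=> hb; rewrite (symbol_class (iota_fil hb) (iota_gr b)) bcoef_iota /=.
by rewrite addrC subrK eqxx.
Qed.

Lemma symbol_iso : strict_iso (fun pq => gr_gr F gr pq) (gr_op F (Bbar_op mt))
  (gr_unit F (Bbar_unit G e)) (fun pq => G pq) m e symbol.
Proof.
split; [split| |].
- exact: symbol_linear.
- exact: symbol_bij.
- move=> pq _ [u /rees_grP hu ->]; rewrite symbolE (hred_gr hu).
  by have := hserG (rees_to_hser u) pq 0; rewrite addr0 subr0; case: (pq).
- move=> a a0; rewrite /gr_op /qop symbolE rees_to_hser_op; last by case: (a) a0.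
  rewrite (fd_red HF) -?map_comp //; by case: (a) a0.
- rewrite /gr_unit /Bbar_unit; case eu: e => [u|] //=; congr Some.
  have Gu := unit_mem HB eu.
  have h0 := hunit_gr Gu.
  have F0 : Bbar_fil G 0 (Bbar_class (hunit G u)).
    by apply: Bbar_fil_class; exact: (@gsum1 _ _ _ _ 0).
  have G0 : Bbar_gr G 0 (Bbar_class (hunit G u)).
    by exists (hunit G u) => //; exact: (@gsum1 _ _ _ _ 0).
  rewrite (symbol_class F0 G0) bcoef_class (@ev_row _ _ _ 0).
    by rewrite /= hunitE.
  exact: (@gsum1 _ _ _ _ 0).
Qed.

End ReesIso.

(** * Complements of a filtration, and maps that are the identity modulo hbar *)

Section ComplementProjections.
Variables (k : comNzRingType) (A : lmodType k) (F : filtration A).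
Variables (gr : int -> submod A) (e : option A) (X : int -> submod A).
Hypothesis HX : graded_complements gr F e X.
Implicit Types (x y : A) (p : int).

Lemma compl_sub p x : X p x -> F p x.
Proof.
by move=> Xx; apply/(compl_sum HX); exists x, 0; split; rewrite ?addr0 //; exact: submod0.
Qed.

Lemma compl_headP p x : F p x ->
  X p (compl_head F X p x) /\ F (p + 1) (x - compl_head F X p x).
Proof.
move=> /(compl_sum HX)[y [z [Xy Fz E]]]; rewrite /compl_head.
case: xgetP => [w _ //|/(_ y)]; case; split=> //.
by rewrite E addrAC subrr add0r.
Qed.

(** The component in the complement is characterized by the decomposition, and so
    does not depend on the choice made in its definition. *)
Lemma compl_headE p x y : X p y -> F (p + 1) (x - y) -> compl_head F X p x = y.
Proof.
move=> Xy Fy; have Fx : F p x.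
  by rewrite -(subrK y x); apply: submodD; [exact: filP | exact: compl_sub].
have [X1 F1] := compl_headP Fx; apply/eqP; rewrite -subr_eq0; apply/eqP.
apply: (compl_direct HX (p := p)); first exact: submodB.
have -> : compl_head F X p x - y = (x - y) - (x - compl_head F X p x).
  by rewrite opprB [RHS]addrC addrA subrK.
exact: submodB.
Qed.

Lemma compl_head_lin p c x y : F p x -> F p y ->
  compl_head F X p (c *: x + y) = c *: compl_head F X p x + compl_head F X p y.
Proof.
move=> /compl_headP[X1 F1] /compl_headP[X2 F2].
apply: compl_headE; first exact: submodL.
by rewrite opprD addrACA -scalerBr; exact: submodL.
Qed.

Lemma compl_head_next p x : F (p + 1) x -> compl_head F X p x = 0.
Proof. by move=> Fx; apply: compl_headE; [exact: submod0 | rewrite subr0]. Qed.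

Lemma compl_proj_mem p r x : F p x -> X (p + r%:Z) (compl_proj F X p r x).
Proof.
elim: r p x => [|r IH] p x Fx /=; have [X1 F1] := compl_headP Fx.
  by rewrite addr0.
by have := IH _ _ F1; rewrite -addrA -PoszD add1n.
Qed.

Lemma compl_proj_lin p r c x y : F p x -> F p y ->
  compl_proj F X p r (c *: x + y) =
  c *: compl_proj F X p r x + compl_proj F X p r y.
Proof.
elim: r p x y => [|r IH] p x y Fx Fy /=; first exact: compl_head_lin.
rewrite compl_head_lin // opprD addrACA -scalerBr IH //.
- by have [] := compl_headP Fx.
- by have [] := compl_headP Fy.
Qed.

Lemma compl_proj0 p r : compl_proj F X p r 0 = 0.
Proof.
have F0 : F p 0 by exact: submod0.
have := compl_proj_lin r (-1) F0 F0.
by rewrite !scaleN1r oppr0 addr0 addNr.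
Qed.

(** An element of [F (p + 1)] has no component in [X p], so that its successive
    components are those computed from [p + 1] on, with a shift; this will give
    the linearity in hbar. *)
Lemma compl_proj_next p r x : F (p + 1) x ->
  compl_proj F X p r x = if r is r'.+1 then compl_proj F X (p + 1) r' x else 0.
Proof. by move=> Fx; case: r => [|r] /=; rewrite compl_head_next ?subr0. Qed.

Lemma compl_proj_id p r x : X p x ->
  compl_proj F X p r x = if r is 0 then x else 0.
Proof.
move=> Xx; have E : compl_head F X p x = x.
  by apply: compl_headE => //; rewrite subrr; exact: submod0.
by case: r => [|r] /=; rewrite E // subrr compl_proj0.
Qed.

(** Applied to the projections to the total degrees: graded complements have
    graded projections. *)
Lemma compl_proj_comm (h : A -> A) :
  (forall x y, h (x + y) = h x + h y) ->
  (forall p x, F p x -> F p (h x)) -> (forall p x, X p x -> X p (h x)) ->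
  forall p r x, F p x -> compl_proj F X p r (h x) = h (compl_proj F X p r x).
Proof.
move=> hD hF hX.
have hh p x : F p x -> compl_head F X p (h x) = h (compl_head F X p x).
  move=> /compl_headP[X1 F1]; apply: compl_headE; first exact: hX.
  by rewrite -(addfB hD); exact: hF.
move=> p r; elim: r p => [|r IH] p x Fx /=; first exact: hh.
by rewrite hh // -(addfB hD) IH //; have [] := compl_headP Fx.
Qed.

End ComplementProjections.

Section HbarAdic.
Variables (k : comNzRingType) (B : lmodType k) (G : int * int -> submod B).
Variable T : hser G -> hser G.
Hypothesis T_lin : forall (c : {poly k}) f g, T (c *: f + g) = c *: T f + T g.
Hypothesis T_local : forall f pq,
  (forall r, hval f pq r = 0) -> forall r, hval (T f) pq r = 0.
Hypothesis T_red : forall f pq, hval (T f) pq 0 = hval f pq 0.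

Let TD := linear_addf T_lin.

Definition hpow_div n (f : hser G) := exists y : hser G, f = 'X^n *: y.

(** Being the identity modulo hbar and linear over k[hbar], the map [T] differs
    from the identity by something that gains one power of hbar. *)
Lemma hpow_divS n f : hpow_div n f -> hpow_div n.+1 (f - T f).
Proof.
case=> g ->; rewrite (linear_scalef T_lin) -scalerBr.
have [|y ->] := (hpowP 1 (g - T g)).1.
  by move=> pq [_|r] //; rewrite hvalB T_red subrr.
by exists y; rewrite scalerA -exprD addn1.
Qed.

(** A kernel element is divisible by every power of hbar. *)
Lemma id_mod_hbar_inj : injective T.
Proof.
suff T0 f : T f = 0 -> f = 0.
  move=> f g E; apply/eqP; rewrite -subr_eq0; apply/eqP/T0.
  by rewrite (addfB TD) E subrr.
move=> Tf; apply: hpow_sep; elim=> [|n [y E]].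
  by exists f; rewrite expr0 scale1r.
by have : hpow_div n f by [exists y]; move=> /hpow_divS; rewrite Tf subr0.
Qed.

(** With N = id - T, the preimage of [h] is the sum of all the N^j h.  It
    converges since N^j h is divisible by hbar^j, and it has finite support because
    locality keeps every N^j h in the support of [h]. *)
Lemma id_mod_hbar_surj h : exists f, T f = h.
Proof.
pose N (f : hser G) := f - T f; pose ej j := iter j N h.
have ejn j : hpow_div j (ej j).
  by elim: j => [|j IH]; [exists h; rewrite expr0 scale1r | exact: hpow_divS].
have ej0 j pq : (forall r, hval h pq r = 0) -> forall r, hval (ej j) pq r = 0.
  move=> hh; elim: j => // j IH r.
  by rewrite [ej j.+1]/(ej j - T (ej j)) hvalB IH (T_local IH) subr0.
have ejlow j pq r : (r < j)%N -> hval (ej j) pq r = 0.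
  by move=> hr; have /hpowP := ejn j; apply.
(* The sum of all the N^j h: those with j > r have no coefficient of hbar^r. *)
pose Y pq r := \sum_(j < r.+1) hval (ej j) pq r.
have YE : hval (hmk G Y) = Y.
  apply: hmkE => [pq r|].
    by rewrite /Y; elim/big_ind: _ => [|x y|j _]; [exact: submod0|exact: submodD|exact: hserG].
  have [s hs] := hsupp h; exists s => pq r hpq; rewrite /Y big1 // => j _.
  by apply: ej0 => r'; exact: hs.
exists (hmk G Y); apply/eqP; rewrite -subr_eq0; apply/eqP/hpow_sep => n.
have S : T (\sum_(j < n) ej j) = h - ej n.
  rewrite (addf_sum TD) -[h - _]opprB -(telescope_sumr (fun j => ej j) (leq0n n)).
  rewrite big_mkord -sumrN; apply: eq_bigr => j _.
  by rewrite opprB [ej j.+1]/(ej j - T (ej j)) opprB addrCA subrr addr0.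
have [y Ey] : hpow_div n (hmk G Y - \sum_(j < n) ej j).
  apply/hpowP => pq r hr; rewrite hvalB hval_sum YE /Y.
  rewrite (big_ord_widen _ (fun j => hval (ej j) pq r) hr) big_mkcond /=.
  rewrite -sumrB big1 // => j _; case: ltnP => hj; first by rewrite subrr.
  by rewrite ejlow ?subrr.
have [z Ez] := ejn n; exists (T y - z).
rewrite scalerBr -Ez -(linear_scalef T_lin) -Ey (addfB TD) S.
by rewrite opprB -addrA [ej n - h + _]addrAC subrr add0r.
Qed.

Lemma id_mod_hbar_bij : bijective T.
Proof. exact: inj_surj_bij id_mod_hbar_inj id_mod_hbar_surj. Qed.

(** If [T f] has no component of bidegree [pq'], then by locality neither has the
    image of the component of [f] of that bidegree; that image is concentrated in
    [pq'], hence zero, and injectivity concludes. *)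
Lemma id_mod_hbar_gr pq f : hser_gr G pq (T f) <-> hser_gr G pq f.
Proof.
split=> /hser_grP h; last first.
  by apply/hser_grP => pq' r hpq; apply: T_local => r'; exact: h.
apply/hser_grP => pq' r hpq.
have cut0 : T (hres (pred1 pq') f) = 0.
  apply: hser_ext => ab s; have [->|hab] := eqVneq ab pq'; last first.
    by apply: T_local => r'; rewrite hresE /= (negPf hab).
  have -> : hres (pred1 pq') f = f - (f - hres (pred1 pq') f) by rewrite opprB addrC subrK.
  rewrite (addfB TD) hvalB h // T_local ?subrr // => r'.
  by rewrite hvalB hresE /= eqxx subrr.
have := id_mod_hbar_inj (etrans cut0 (esym (addf0 TD))).
by move=> /(congr1 (fun g : hser G => hval g pq' r)); rewrite hresE /= eqxx.
Qed.

Lemma id_mod_hbar_red f : hred G (T f) = hred G f.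
Proof. by rewrite /hred; congr (\sum_(pq \in _) _); apply/funext => pq; exact: T_red. Qed.

End HbarAdic.

(** * The Rees algebra as a formal deformation *)

Lemma transport_map (S T : choiceType) (t0 : S) (f : S -> T) (m : seq S -> S) a :
  injective f -> transport t0 f m (map f a) = f (m a).
Proof.
move=> fI; rewrite /transport -map_comp; congr (f (m _)).
rewrite -[RHS]map_id; apply: eq_map => x /=; apply: fI.
by case: xgetP => [y _ ->//|/(_ x)/=]; case.
Qed.

Section Theta.
Variables (k : fieldType) (B : lmodType k) (G : int * int -> submod B).
Variables (m : seq B -> B) (e : option B) (mt : seq (hser G) -> hser G).
Hypothesis HB : bigraded_ainf (@bigr_trivial k) (fun pq => G pq) m e.
Hypothesis HF : formal_deformation m e mt.
Notation F := (Bbar_fil G).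
Notation gr := (Bbar_gr G).
Notation ebar := (Bbar_unit G e).

Lemma row_complement_lin_closed p :
  lin_closed (fun x : Bbar G => forall pq, pq.1 != p -> bcoef x pq = 0).
Proof.
split=> [pq _|c x y hx hy pq h]; first exact: bcoef0.
by rewrite bcoef_lin hx // hy // scaler0 addr0.
Qed.

(** The complement of [F (p + 1)] in [F p] that the bigrading of [B] provides; it
    shows that choices of complements exist. *)
Definition row_complement p := Submod (row_complement_lin_closed p).

Lemma row_complements : graded_complements gr F ebar row_complement.
Proof.
split.
- move=> p x hx; apply: Bbar_decomp => n // _ pq hp.
  by rewrite bcutE hx // if_same.
- move=> p x; split=> [/Bbar_filP hx|[y [z [hy /Bbar_filP hz ->]]]]; last first.
    apply/Bbar_filP => pq hp; rewrite bcoefD hy ?hz ?addr0 //; last by rewrite lt_eqF.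
    by apply: lt_trans hp _; rewrite ltrDl.
  exists (bcut (fun pq => pq.1 == p) x), (x - bcut (fun pq => pq.1 == p) x).
  split; last by rewrite addrC subrK.
    by move=> pq /negPf h; rewrite bcutE h.
  apply/Bbar_filP => pq hp; rewrite bcoefB bcutE; case: eqP => h; first by rewrite subrr.
  by rewrite subr0; apply: hx; lia.
- move=> p x hx /Bbar_filP h; apply: bcoef_inj => pq; rewrite bcoef0.
  have [E|/hx//] := eqVneq pq.1 p.
  by apply: h; rewrite E ltrDl.
- move=> u; rewrite /Bbar_unit; case eu: e => [v|] //= [<-] pq hp.
  have Gv := unit_mem HB eu.
  rewrite bcoef_class (@ev_row _ _ _ 0); last by apply: (@gsum1 _ _ _ _ 0) => //; exact: hunit_gr.
  case: leP => // hp0; rewrite hunitE //.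
  by case: andP => // -[_]; move: hp hp0; lia.
Qed.

Variable X : int -> submod (Bbar G).
Hypothesis HX : graded_complements gr F ebar X.

Lemma bcut_fil P p (x : Bbar G) : F p x -> F p (bcut P x).
Proof.
by move=> /Bbar_filP h; apply/Bbar_filP => pq hp; rewrite bcutE h // if_same.
Qed.

Lemma bcut_compl n p x : X p x -> X p (bcut (on_total n) x).
Proof.
move=> /(compl_graded HX).
apply: (@gsum_ind _ _ _ _ (fun x => X p (bcut (on_total n) x))).
- by rewrite (addf0 (bcutD _)); exact: submod0.
- by move=> y z hy hz; rewrite bcutD; exact: submodD.
- move=> n' y _ [Xy gy]; have [->|nn] := eqVneq n n'; first by rewrite bcut_id.
  by rewrite (bcut_other gy nn); exact: submod0.
Qed.

Lemma compl_proj_bcut n p r x : F p x ->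
  compl_proj F X p r (bcut (on_total n) x) = bcut (on_total n) (compl_proj F X p r x).
Proof.
apply: (compl_proj_comm HX); first exact: bcutD.
- by move=> p' y; exact: bcut_fil.
- by move=> p' y; exact: bcut_compl.
Qed.

Lemma compl_proj_fil p r x : F p x -> F (p + r%:Z) (compl_proj F X p r x).
Proof. by move=> Fx; exact/(compl_sub HX)/(compl_proj_mem HX). Qed.

(** Total degrees of the quotient are separated by their coefficients, so that
    the abstract component is obtained by restricting the coefficients. *)
Lemma componentE n (x : Bbar G) :
  component (fun n => gr n) n x = bcut (on_total n) x.
Proof.
rewrite /component; case: xgetP => [y _ [gy hy]|hn].
  rewrite -{1}(bcut_id gy) -[x in RHS](subrK y) bcutD.
  suff -> : bcut (on_total n) (x - y) = 0 by rewrite add0r.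
  apply: (@gsum_ind _ _ _ _ (fun x => bcut (on_total n) x = 0)) hy.
  + exact: (addf0 (bcutD _)).
  + by move=> z w hz hw; rewrite bcutD hz hw addr0.
  + by move=> n' z nn gz; apply: (bcut_other gz); apply/eqP => E; exact: nn.
exfalso; apply: (hn (bcut (on_total n) x)); split; first exact: bcut_gr.
suff h : gsum (fun j => j <> n) (fun j y => True /\ gr j y) (x - bcut (on_total n) x).
  by apply: (gsum_map (f := id) _ _ h) => // j y [].
apply: Bbar_decomp => // j /contrapT ->.
by rewrite (addfB (bcutD _)) (bcut_id (bcut_gr n x)) subrr.
Qed.

Lemma compl_proj_rees_deg (u : rees F) : exists s : seq (int * int),
  forall pq r, pq \notin s ->
    component (fun n => gr n) (pq.1 + pq.2) (compl_proj F X pq.1 r (rval u pq.1)) = 0.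
Proof.
have [s hs] := rsupp u; have [D hD] := rees_deg u.
exists [seq (p, n - p) | p <- s, n <- D] => -[p q] r hpq /=.
rewrite componentE -compl_proj_bcut; last exact: rvalF.
suff -> : bcut (on_total (p + q)) (rval u p) = 0 by exact: (compl_proj0 HX).
apply: bcoef_inj => ab; rewrite bcutE bcoef0 /on_total; case: eqP => // E.
have [sp|/hs->] := boolP (p \in s); last exact: bcoef0.
apply: hD; rewrite E; apply: contra hpq => hn; apply/allpairsP; exists (p, p + q).
by split=> //=; congr (_, _); lia.
Qed.

Lemma rees_seriesE (u : rees F) pq r : hval (rees_series gr X u) pq r =
  gr_class F (pq.1 + r%:Z)
    (bcut (on_total (pq.1 + pq.2)) (compl_proj F X pq.1 r (rval u pq.1))).
Proof.
rewrite [rees_series gr X u]/(hmk _ _) hmkE ?componentE // => [ab s|].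
  rewrite componentE /gr_class.
  set y := bcut _ _.
  have Fy : F (ab.1 + s%:Z) y by apply: bcut_fil; apply: compl_proj_fil; exact: rvalF.
  exists (rmono F (ab.1 + s%:Z) y) => //; split=> [|p hp] /=; rewrite rmonoE //.
    rewrite eqxx (_ : _ + _ = ab.1 + ab.2); first exact: bcut_gr.
    by rewrite addrACA subrr addr0.
  by move/eqP/negPf: hp => ->.
have [s hs] := compl_proj_rees_deg u; exists s => ab r' /(hs _ r') ->.
rewrite /gr_class; rewrite -[RHS](qpi0 (gr_ker F)); congr (qpi _ _).
apply: rees_ext => p; rewrite rmonoE; last exact: submod0.
by rewrite if_same.
Qed.

Lemma symbol0 : symbol (0 : assoc_gr F) = 0.
Proof. exact: (addf0 (linear_addf (symbol_linear HB))). Qed.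

(** The coefficient of hbar^r in bidegree [pq] is the leading coefficient of the
    [r]-th component with respect to the complements.  The results below use only
    this formula, with the map itself kept as a variable. *)
Lemma hser_map_symbolE (u : rees F) pq r :
  hval (hser_map G (@symbol _ _ G) (rees_series gr X u)) pq r =
  bcoef (compl_proj F X pq.1 r (rval u pq.1)) (pq.1 + r%:Z, pq.2 - r%:Z).
Proof.
have H ab s : symbol (hval (rees_series gr X u) ab s) =
    bcoef (compl_proj F X ab.1 s (rval u ab.1)) (ab.1 + s%:Z, ab.2 - s%:Z).
  rewrite rees_seriesE (symbol_class HB (p := ab.1 + s%:Z) (n := ab.1 + ab.2)).
  - rewrite bcutE /on_total /= (_ : (_ == _) = true); last by lia.
    by congr (bcoef _ (_, _)); lia.
  - by apply: bcut_fil; apply: compl_proj_fil; exact: rvalF.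
  - exact: bcut_gr.
rewrite /hser_map [insubd _ _]/(hmk _ _) hmkE ?H // => [ab s|].
  by rewrite H; exact: bcoefG.
have [s hs] := hsupp (rees_series gr X u); exists s => ab r' /(hs _ r') ->.
exact: symbol0.
Qed.

Variable theta : rees F -> hser G.
Hypothesis thetaE : forall u pq r, hval (theta u) pq r =
  bcoef (compl_proj F X pq.1 r (rval u pq.1)) (pq.1 + r%:Z, pq.2 - r%:Z).

Lemma theta_k_linear c (u v : rees F) :
  theta (c *: (u : reesk F) + v : reesk F) =
  c *: (theta u : hserk G) + theta v :> hserk G.
Proof.
apply: hser_ext => pq r.
have hL (f g : hser G) : hval (c *: (f : hserk G) + g : hserk G) pq r =
  c *: hval f pq r + hval g pq r by [].
rewrite [RHS]hL (thetaE u) (thetaE v) [LHS]thetaE.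
rewrite -bcoef_lin -(compl_proj_lin HX) //; exact: rvalF.
Qed.

Lemma theta_linear (c : {poly k}) u v : theta (c *: u + v) = c *: theta u + theta v.
Proof.
apply: polymod_linear => [|x]; first exact: theta_k_linear.
apply: hser_ext => pq r.
rewrite hvalX thetaE rvalX (compl_proj_next HX); last exact: rvalF.
case: r => [|r]; first exact: bcoef0.
by rewrite thetaE /=; congr (bcoef _ (_, _)); lia.
Qed.

(** The series are read as an element of the Rees module and expanded again along
    the complements. *)
Definition comparison (f : hser G) : hser G := theta (hser_to_rees f).

Lemma comparison_linear (c : {poly k}) f g : comparison (c *: f + g) = c *: comparison f + comparison g.
Proof. by rewrite /comparison hser_to_rees_linear theta_linear. Qed.

(** Complements are graded, so the coefficients of bidegree [pq] of the result
    depend only on the part of total degree [pq.1 + pq.2] of the row [pq.1]. *)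
Lemma comparison_local f pq : (forall r, hval f pq r = 0) -> forall r, hval (comparison f) pq r = 0.
Proof.
move=> h r; rewrite thetaE; set u := hser_to_rees f.
have -> : bcoef (compl_proj F X pq.1 r (rval u pq.1)) (pq.1 + r%:Z, pq.2 - r%:Z) =
  bcoef (compl_proj F X pq.1 r (bcut (on_total (pq.1 + pq.2)) (rval u pq.1)))
    (pq.1 + r%:Z, pq.2 - r%:Z).
  rewrite compl_proj_bcut; last exact: rvalF.
  by rewrite bcutE /on_total /= addrACA subrr addr0 eqxx.
suff -> : bcut (on_total (pq.1 + pq.2)) (rval u pq.1) = 0.
  by rewrite (compl_proj0 HX) bcoef0.
apply: bcoef_inj => ab; rewrite bcutE bcoef0 /on_total; case: eqP => // E.
rewrite bcoef_rees /u hser_to_reesK; case: leP => // _.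
by rewrite (_ : (pq.1, _) = pq) //; case: (pq) E => a b /= E; congr (_, _); lia.
Qed.

(** An element of [F p] and its component in the complement agree modulo
    [F (p + 1)], hence have the same coefficients of first degree [p]. *)
Lemma comparison_red f pq : hval (comparison f) pq 0 = hval f pq 0.
Proof.
rewrite thetaE /= -[in RHS](hser_to_reesK f) rees_to_hserE.
have [_ /Bbar_filP h] := compl_headP HX (rvalF (hser_to_rees f) pq.1).
apply/esym/eqP; rewrite -subr_eq0 -bcoefB; apply/eqP; apply: h => /=; lia.
Qed.

Lemma comparison_bij : bijective comparison.
Proof. exact: (id_mod_hbar_bij comparison_linear comparison_local comparison_red). Qed.

Lemma comparison_gr pq f : hser_gr G pq (comparison f) <-> hser_gr G pq f.
Proof. exact: (id_mod_hbar_gr comparison_linear comparison_local comparison_red). Qed.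

Lemma theta_comparison u : theta u = comparison (rees_to_hser u).
Proof. by rewrite /comparison rees_to_hserK. Qed.

Lemma theta_bij : bijective theta.
Proof.
have [Q QK KQ] := comparison_bij.
exists (@hser_to_rees _ _ G \o Q) => [u|f] /=; last exact: KQ.
by rewrite theta_comparison QK rees_to_hserK.
Qed.

Lemma theta_gr pq u : hser_gr G pq (theta u) <-> rees_gr F gr pq u.
Proof. by rewrite theta_comparison comparison_gr rees_grP. Qed.

Lemma theta_iso : graded_iso (rees_gr F gr) (hser_gr G) theta.
Proof.
split; [exact: theta_linear|exact: theta_bij|].
by move=> pq u /theta_gr.
Qed.

Definition transported : seq (hser G) -> hser G :=
  transport 0 theta (rees_op F (Bbar_op mt)).

Lemma transported_theta us :
  transported (map theta us) = theta (rees_op F (Bbar_op mt) us).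
Proof. exact/transport_map/bij_inj/theta_bij. Qed.

Lemma comparison_op a : a <> [::] -> comparison (mt a) = transported (map comparison a).
Proof.
move=> a0; rewrite /comparison (hser_to_rees_op HF) // -transported_theta.
by rewrite -map_comp.
Qed.

(** This is where the unit must lie in the complement: its expansion then has only
    the constant term. *)
Lemma comparison_unit : omap comparison (omap (hunit G) e) = omap (hunit G) e.
Proof.
case eu: e => [u|] //=; congr Some.
have Gu := unit_mem HB eu.
have u0 : in_row 0 (hunit G u) by apply: (@gsum1 _ _ _ _ 0) => //; exact: hunit_gr.
have Xu : X 0 (Bbar_class (hunit G u)) by apply: (compl_unit HX); rewrite /Bbar_unit eu.
apply: hser_ext => pq r; rewrite thetaE hser_to_reesE (row_of_row _ u0).
have [E|hp] := eqVneq 0 pq.1; last first.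
  rewrite [Bbar_class 0]qpi0 (compl_proj0 HX) bcoef0 hunitE //.
  by case: eqP => // E; rewrite E eqxx in hp.
rewrite -E (compl_proj_id HX) //; case: r => [|r].
  rewrite bcoef_class (ev_row _ u0) /=.
  by congr (hval _ _ _); case: (pq) E => a b /= <-; congr (_, _); lia.
by rewrite bcoef0 hunitE // andbF.
Qed.

Lemma transported_bigraded :
  bigraded_ainf (@bigr_hbar k) (hser_gr G) transported (omap (hunit G) e).
Proof.
exact: (bigraded_transport comparison_linear comparison_bij comparison_op comparison_unit comparison_gr
  (hser_bigraded_ainf HB HF)).
Qed.

(** The transported operations form an exact A-infinity algebra, which reduces to
    each truncation; modulo hbar nothing has changed, since the comparison map is
    the identity there. *)
Lemma transported_formal : formal_deformation m e transported.
Proof.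
have [Ha _ _ Hd _] := transported_bigraded.
have ml := ainf_linear Ha.
split=> //.
- move=> N N0; set S := hpow_submod (hser G) N.
  have [Hdir Hsc _ _ _ _] := fd_trunc HF N0.
  have st := hpow_stable ml (N := N).
  apply: (@ainf_image _ _ (hser G) (trunc (hser G) N) (qpi S) _ _ _ _ _ _
    _ _ _ _ _ Hdir Hsc _ Ha).
  + by move=> x y; exact: qpiD.
  + by move=> y; exists (qrepr y); exact: qreprK.
  + move=> n y; split=> [|[x hx ->]]; last first.
      by apply: gsum_map hx => [a b|pq a ha]; [exact: qpiD | exists a].
    apply: (@gsum_ind _ _ _ _ (fun y => exists2 x, total (hser_gr G) n x & y = qpi S x)).
    * by exists 0; [apply/totalP | rewrite qpi0].
    * move=> _ _ [a /totalP ha ->] [b /totalP hb ->]; exists (a + b); last by rewrite qpiD.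
      by apply/totalP => pq r h; rewrite hvalD ha // hb // addr0.
    * by move=> pq _ E [a ha ->]; exists a => //; exact: (gsum1 E ha).
  + by move=> a _; rewrite qop_qpi.
  + by case: (e).
  + move=> a b c x y; exact: (qop_multilinear ml st).
- move=> a a0; have [Q QK KQ] := comparison_bij.
  have E : a = map comparison (map Q a) by rewrite -map_comp map_id_in // => z _ /=.
  have b0 : map Q a <> [::] by case: (a) a0.
  rewrite E -comparison_op // (id_mod_hbar_red comparison_red) (fd_red HF) // -!map_comp.
  by congr (m _); apply: eq_map => z /=; rewrite (id_mod_hbar_red comparison_red).
Qed.

Lemma comparison_iso : strict_iso (hser_gr G) mt (omap (hunit G) e) (hser_gr G)
  transported (omap (hunit G) e) comparison.
Proof.
split; [split|exact: comparison_op|exact: comparison_unit].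
- exact: comparison_linear.
- exact: comparison_bij.
- by move=> pq f /comparison_gr.
Qed.

End Theta.

Theorem proposition4p2 (k : fieldType) (B : lmodType k)
    (G : int * int -> submod B) (m : seq B -> B) (e : option B)
    (mt : seq (hser G) -> hser G) :
  bigraded_ainf (@bigr_trivial k) (fun pq => G pq) m e ->
  formal_deformation m e mt ->
  let F := Bbar_fil G in
  let gr := Bbar_gr G in
  let mbar := Bbar_op mt in
  let ebar := Bbar_unit G e in
  let eh := omap (hunit G) e in
  [/\ filtered_ainf (fun n => gr n) F mbar ebar,
      bigraded_ainf (@bigr_hbar k) (hser_gr G) mt eh,
      bigraded_ainf (@bigr_hbar k) (rees_gr F gr) (rees_op F mbar)
        (rees_unit F ebar),
      (exists Phi : hser G -> rees F,
        strict_iso (hser_gr G) mt eh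
          (rees_gr F gr) (rees_op F mbar) (rees_unit F ebar) Phi) &
      exists beta : assoc_gr F -> B,
        [/\ strict_iso (fun pq => gr_gr F gr pq) (gr_op F mbar)
              (gr_unit F ebar) (fun pq => G pq) m e beta,
            (forall n p (b : gcompl G n), gcompl_fil p b ->
              beta (gr_class F p (iota' b)) = b p),
            (exists X, graded_complements gr F ebar X) &
            forall X, graded_complements gr F ebar X ->
              let theta (u : rees F) : hser G :=
                hser_map G beta (rees_series gr X u) in
              let mX := transport 0 theta (rees_op F mbar) in
              [/\ graded_iso (rees_gr F gr) (hser_gr G) theta,
                  formal_deformation m e mX &
                  exists2 Psi : hser G -> hser G,
                    strict_iso (hser_gr G) mt eh (hser_gr G) mX eh Psi &
                    forall x, hred G (Psi x) = hred G x]]].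
Proof.
move=> HB HF F gr mbar ebar eh; split.
- exact: (Bbar_filtered HB HF).
- exact: (hser_bigraded_ainf HB HF).
- exact: (rees_bigraded HB HF).
- exists (@hser_to_rees _ _ G); exact: (hser_to_rees_iso HB HF).
exists (@symbol _ _ G); split.
- exact: (symbol_iso HB HF).
- by move=> n p b; exact: (symbol_iota HB).
- by exists (@row_complement _ _ G); exact: (row_complements HB).
move=> X HX; split.
- exact: (theta_iso HX (hser_map_symbolE HB HX)).
- exact: (transported_formal HB HF HX (hser_map_symbolE HB HX)).
- exists (comparison (fun u => hser_map G (@symbol _ _ G) (rees_series gr X u))).
    exact: (comparison_iso HB HF HX (hser_map_symbolE HB HX)).
  by move=> x; apply: id_mod_hbar_red; exact: (comparison_red HX (hser_map_symbolE HB HX)).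
Qed.
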